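(* Let $\mathcal{H}\in C^1([-1,1])$ be such that there exists a rotational $\mathcal{H}$-sphere $S_{\mathcal{H}}$ in $\mathbb{H}^2\times\mathbb{R}$. Then $2|\mathcal{H}(y)|>\sqrt{1-y^2}$ for every $y\in[-1,1]$. In particular, $\mathcal{H}$ never vanishes.
   Context: $\mathbb{H}^2$ is the hyperbolic plane of curvature $-1$. $\mathbb{H}^2\times\mathbb{R}$ carries the product metric, and $\partial_z$ is the unit vertical Killing field, the gradient of the height function (projection onto $\mathbb{R}$). Given $\mathcal{H}\in C^1([-1,1])$, an immersed oriented surface $\Sigma$ in $\mathbb{H}^2\times\mathbb{R}$ with unit normal $\eta$ is an $\mathcal{H}$-surface if its mean curvature $H_\Sigma$ with respect to $\eta$ (half the sum of the principal curvatures) satisfies $H_\Sigma(p)=\mathcal{H}(\nu(p))$ for all $p\in\Sigma$, where $\nu(p)=\langle\eta_p,\partial_z\rangle$ is the angle function. A sphere is a closed (compact, without boundary) immersed surface of genus zero, possibly with self-intersections; an $\mathcal{H}$-sphere is an $\mathcal{H}$-surface that is a sphere. Rotational means generated by rotating, around a vertical line $\{p\}\times\mathbb{R}$, a regular curve lying in a vertical plane (geodesic of $\mathbb{H}^2$ times $\mathbb{R}$) containing that line. Standing assumption: the (possible) zeros of $\mathcal{H}$ are isolated and of finite multiplicity. *)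

(* Defs.v *)
(* The ambient space H^2 x R is realised inside L^3 x R, where L^3 is R^3 with
   the Lorentz product -dx0^2 + dx1^2 + dx2^2 and H^2 is the upper sheet of the
   hyperboloid <p,p> = -1, on which the induced metric is Riemannian of
   curvature -1. *)
From Stdlib Require Import Reals.
From Coquelicot Require Import Coquelicot.
Open Scope R_scope.

Definition vec3 : Type := (R * R * R)%type.
Definition vec4 : Type := (vec3 * R)%type.

Definition x0 (p : vec3) : R := fst (fst p).
Definition x1 (p : vec3) : R := snd (fst p).
Definition x2 (p : vec3) : R := snd p.

Definition lorentz (p q : vec3) : R := - (x0 p * x0 q) + x1 p * x1 q + x2 p * x2 q.
Definition metric (v w : vec4) : R := lorentz (fst v) (fst w) + snd v * snd w.

Definition in_H2 (p : vec3) : Prop := lorentz p p = -1 /\ 0 < x0 p.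
Definition in_H2xR (q : vec4) : Prop := in_H2 (fst q).
(* [w] is tangent to H^2 x R at [q]. *)
Definition tangent_H2xR (q w : vec4) : Prop := lorentz (fst q) (fst w) = 0.
Definition dz : vec4 := ((0, 0, 0), 1).

(** Calculus on maps from open subsets of R^2 to R^3 and R^4 *)

Definition Derive3 (f : R -> vec3) (t : R) : vec3 :=
  (Derive (fun s => x0 (f s)) t, Derive (fun s => x1 (f s)) t,
   Derive (fun s => x2 (f s)) t).
Definition Derive4 (f : R -> vec4) (t : R) : vec4 :=
  (Derive3 (fun s => fst (f s)) t, Derive (fun s => snd (f s)) t).

Definition du3 (F : R -> R -> vec3) (u v : R) : vec3 := Derive3 (fun s => F s v) u.
Definition dv3 (F : R -> R -> vec3) (u v : R) : vec3 := Derive3 (fun s => F u s) v.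
Definition du4 (F : R -> R -> vec4) (u v : R) : vec4 := Derive4 (fun s => F s v) u.
Definition dv4 (F : R -> R -> vec4) (u v : R) : vec4 := Derive4 (fun s => F u s) v.

(* [Cn3 n F u v] on every point (u, v) of an open set says that F is C^n there;
   n = 0 is continuity. *)
Definition Cn3 (n : nat) (F : R -> R -> vec3) (u v : R) : Prop :=
  ex_diff_n (fun s t => x0 (F s t)) n u v /\
  ex_diff_n (fun s t => x1 (F s t)) n u v /\
  ex_diff_n (fun s t => x2 (F s t)) n u v.
Definition Cn4 (n : nat) (F : R -> R -> vec4) (u v : R) : Prop :=
  Cn3 n (fun s t => fst (F s t)) u v /\ ex_diff_n (fun s t => snd (F s t)) n u v.

Definition independent {V : NormedModule R_AbsRing} (v w : V) : Prop :=
  forall a b : R, plus (scal a v) (scal b w) = zero -> a = 0 /\ b = 0.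

(* [f] is C^1 on [a, b] with derivative [df], one-sided at the endpoints. *)
Definition C1_on {V : NormedModule R_AbsRing} (a b : R) (f df : R -> V) : Prop :=
  forall x : R, a <= x <= b ->
    filterdiff f (within (fun y => a <= y <= b) (locally x))
      (fun y : R => scal y (df x)) /\
    filterlim df (within (fun y => a <= y <= b) (locally x)) (locally (df x)).

(** Local geometry of immersed surfaces in H^2 x R *)

(* The Levi-Civita connection of H^2 x R is the tangential part of the flat
   connection of L^3 x R.  Hence, for a normal N tangent to H^2 x R, the second
   fundamental form of F with respect to N has coefficients <F_uu, N>,
   <F_uv, N>, <F_vv, N>. *)
Definition det_pencil (F : R -> R -> vec4) (N : vec4) (u v t : R) : R :=
  let Fu := du4 F u v in
  let Fv := dv4 F u v in
  (metric (du4 (du4 F) u v) N - t * metric Fu Fu)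
  * (metric (dv4 (dv4 F) u v) N - t * metric Fv Fv)
  - (metric (du4 (dv4 F) u v) N - t * metric Fu Fv) ^ 2.

Definition det_first_form (F : R -> R -> vec4) (u v : R) : R :=
  metric (du4 F u v) (du4 F u v) * metric (dv4 F u v) (dv4 F u v)
  - metric (du4 F u v) (dv4 F u v) ^ 2.

(* k1, k2 are the eigenvalues, with multiplicity, of the shape operator
   A = I^-1 II, since det (II - t I) = det I * det (A - t). *)
Definition principal_curvatures (F : R -> R -> vec4) (N : vec4) (u v k1 k2 : R) : Prop :=
  forall t : R,
    det_pencil F N u v t = det_first_form F u v * ((k1 - t) * (k2 - t)).

Definition is_mean_curvature (F : R -> R -> vec4) (N : vec4) (u v h : R) : Prop :=
  exists k1 k2 : R, principal_curvatures F N u v k1 k2 /\ h = (k1 + k2) / 2.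

(** The two-sphere as a regular surface of R^3 *)

Definition in_S2 (p : vec3) : Prop := x0 p ^ 2 + x1 p ^ 2 + x2 p ^ 2 = 1.

Record S2_chart (U : R -> R -> Prop) (phi : R -> R -> vec3) : Prop := {
  chart_open : forall u v, U u v -> locally_2d U u v;
  chart_S2 : forall u v, U u v -> in_S2 (phi u v);
  chart_C2 : forall u v, U u v -> Cn3 2 phi u v;
  chart_regular : forall u v, U u v -> independent (du3 phi u v) (dv3 phi u v)
}.

(* Self-diffeomorphisms of S^2: bijections that are local diffeomorphisms, i.e.
   carry local parametrisations to local parametrisations. *)
Record S2_diffeo (psi : vec3 -> vec3) : Prop := {
  diffeo_S2 : forall p, in_S2 p -> in_S2 (psi p);
  diffeo_inj : forall p q, in_S2 p -> in_S2 q -> psi p = psi q -> p = q;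
  diffeo_surj : forall q, in_S2 q -> exists p, in_S2 p /\ psi p = q;
  diffeo_chart : forall U phi,
    S2_chart U phi -> S2_chart U (fun u v => psi (phi u v))
}.

(** Immersed spheres: up to diffeomorphism of the domain, the closed surface of
    genus zero is S^2.  Only the values of [X] and [eta] on S^2 matter. *)

Record immersed_sphere (X : vec3 -> vec4) : Prop := {
  sphere_H2xR : forall p, in_S2 p -> in_H2xR (X p);
  sphere_C2 : forall U phi, S2_chart U phi ->
    forall u v, U u v -> Cn4 2 (fun s t => X (phi s t)) u v;
  sphere_immersion : forall U phi, S2_chart U phi ->
    forall u v, U u v ->
      independent (du4 (fun s t => X (phi s t)) u v)
                  (dv4 (fun s t => X (phi s t)) u v)
}.

Record unit_normal (X eta : vec3 -> vec4) : Prop := {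
  normal_tangent : forall p, in_S2 p -> tangent_H2xR (X p) (eta p);
  normal_unit : forall p, in_S2 p -> metric (eta p) (eta p) = 1;
  normal_continuous : forall U phi, S2_chart U phi ->
    forall u v, U u v -> Cn4 0 (fun s t => eta (phi s t)) u v;
  normal_orthogonal : forall U phi, S2_chart U phi ->
    forall u v, U u v ->
      metric (du4 (fun s t => X (phi s t)) u v) (eta (phi u v)) = 0 /\
      metric (dv4 (fun s t => X (phi s t)) u v) (eta (phi u v)) = 0
}.

Definition angle (eta : vec3 -> vec4) (p : vec3) : R := metric (eta p) dz.

Definition H_sphere (H : R -> R) (X : vec3 -> vec4) : Prop :=
  immersed_sphere X /\
  exists eta : vec3 -> vec4,
    unit_normal X eta /\
    forall U phi, S2_chart U phi ->
      forall u v, U u v ->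
        is_mean_curvature (fun s t => X (phi s t)) (eta (phi u v)) u v
          (H (angle eta (phi u v))).

(** Rotational spheres *)

Definition frame (p e1 e2 : vec3) : Prop :=
  in_H2 p /\ lorentz p e1 = 0 /\ lorentz p e2 = 0 /\
  lorentz e1 e1 = 1 /\ lorentz e2 e2 = 1 /\ lorentz e1 e2 = 0.

(* Rotation of angle [theta] around {p} x R: in the Lorentz-orthonormal basis
   (p, e1, e2) it fixes p and rotates the plane spanned by e1 and e2. *)
Definition rotation (p e1 e2 : vec3) (theta : R) (q : vec4) : vec4 :=
  let a := lorentz (fst q) e1 in
  let b := lorentz (fst q) e2 in
  (plus (scal (- lorentz (fst q) p) p)
     (plus (scal (a * cos theta - b * sin theta) e1)
           (scal (a * sin theta + b * cos theta) e2)),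
   snd q).

Definition geodesic (p e : vec3) (t : R) : vec3 :=
  plus (scal (cosh t) p) (scal (sinh t) e).

Definition in_vertical_plane (p e : vec3) (q : vec4) : Prop :=
  exists t : R, fst q = geodesic p e t.

Definition regular_curve (a b : R) (alpha : R -> vec4) : Prop :=
  exists dalpha : R -> vec4,
    C1_on a b alpha dalpha /\
    forall s : R, a <= s <= b -> dalpha s <> zero.

(* Colatitude s in [0, PI], longitude theta. *)
Definition polar (s theta : R) : vec3 :=
  (sin s * cos theta, sin s * sin theta, cos s).

(* Up to a diffeomorphism psi of the domain (a reparametrisation of the immersed
   surface), X is swept out by rotating the meridian alpha, which lies in a
   vertical plane through the axis {p} x R. *)
Definition rotational_sphere (X : vec3 -> vec4) : Prop :=
  exists (p e1 e2 : vec3) (psi : vec3 -> vec3) (alpha : R -> vec4),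
    frame p e1 e2 /\
    S2_diffeo psi /\
    regular_curve 0 PI alpha /\
    (forall s, 0 <= s <= PI -> in_vertical_plane p e1 (alpha s)) /\
    (forall s theta, 0 <= s <= PI ->
       X (psi (polar s theta)) = rotation p e1 e2 theta (alpha s)).

(** Assumptions on the prescribed function, defined on [-1, 1] *)

Definition C1_function (H : R -> R) : Prop := exists dH : R -> R, C1_on (-1) 1 H dH.

Definition isolated_zeros (H : R -> R) : Prop :=
  forall y0, -1 <= y0 <= 1 -> H y0 = 0 ->
    locally y0 (fun y => -1 <= y <= 1 -> H y = 0 -> y = y0).

(* Finite multiplicity for a function that is only C^1: H is not o((y - y0)^n)
   for some n, i.e. it does not vanish to infinite order at y0. *)
Definition zeros_of_finite_multiplicity (H : R -> R) : Prop :=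
  forall y0, -1 <= y0 <= 1 -> H y0 = 0 ->
    exists n : nat,
      ~ filterlim (fun y => H y / (y - y0) ^ n)
          (within (fun y => -1 <= y <= 1 /\ y <> y0) (locally y0)) (locally 0).

(* Main.v *)
Require Import Defs.
From Stdlib Require Import Reals Lra FunctionalExtensionality.
From Coquelicot Require Import Coquelicot.
Open Scope R_scope.

(** The meridian of a rotational surface is a curve [(rho, z)] in a half-plane,
    [rho] being the distance to the axis. If [theta] is the angle of its tangent
    with the horizontal, the parameter is arc length and the orientation is such
    that the angle function is [cos theta], then prescribing the mean curvature
    means [theta' = 2 H(cos theta) - coth rho * sin theta].

    Suppose [2 |H y| <= sqrt (1 - y^2)] for some [y] in the open interval. At a
    point where [cos theta = y] one has [|sin theta| = sqrt (1 - y^2)], and since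
    [coth rho > 1] the second term wins: [theta'] has the sign of [- sin theta],
    so [(cos theta)' > 0]. Hence [cos theta] can only cross the level [y] upwards
    ([circle_barrier]). On a sphere, however, the meridian leaves the axis
    horizontally, with [cos theta = 1], and returns to it horizontally, with
    [cos theta = -1] ([profile_oriented_bound]): a contradiction. So the strict
    bound holds for [|y| < 1]. At [y = +- 1] it says that [H y <> 0], and indeed a
    differentiable function vanishing there would decay at least linearly, faster
    than [sqrt (1 - y^2)] ([endpoint_nonzero]).

    The rest is the passage from the immersed sphere to these scalar equations,
    collected in the record [profile]. In the interior of the meridian they come
    from the fundamental forms in polar coordinates
    ([mean_curvature_profile]). Polar coordinates break down at the poles; there
    a chart around the whole great circle shows that the meridian is still
    regular, and its symmetry under the half-turn around the axis forces its
    velocity to be horizontal ([normal_at_pole]). The sign ambiguities (the side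
    of the axis on which the meridian lies, the orientation of the normal) are
    removed by [profile_flip_axis] and [profile_flip_normal]. *)

(** * The barrier argument *)

Lemma is_derive_pos_below (f : R -> R) (c l : R) :
  is_derive f c l -> 0 < l -> f c = 0 ->
  exists d, 0 < d /\ forall y, c - d < y < c -> f y < 0.
Proof.
  intros Hd Hl H0. apply is_derive_Reals in Hd.
  destruct (Hd (l / 2)) as [d Hd']; [lra|].
  exists d. split; [apply cond_pos|]. intros y Hy.
  specialize (Hd' (y - c)).
  replace (c + (y - c)) with y in Hd' by ring.
  rewrite H0 in Hd'.
  assert (Hne : y - c <> 0) by lra.
  specialize (Hd' Hne).
  rewrite (Rabs_left (y - c)) in Hd' by lra.
  assert (Hlt : - (y - c) < d) by lra.
  specialize (Hd' Hlt). apply Rabs_def2 in Hd'.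
  assert (Hq : 0 < (f y - 0) / (y - c)) by lra.
  assert (f y = (f y - 0) / (y - c) * (y - c)) by (field; lra).
  nra.
Qed.

Lemma is_derive_pos_locally (f : R -> R) (c l : R) :
  is_derive f c l -> 0 < f c ->
  exists d, 0 < d /\ forall y, Rabs (y - c) < d -> 0 < f y.
Proof.
  intros Hd Hc.
  assert (Hcont : continuous f c)
    by (apply (ex_derive_continuous (V := R_NormedModule)); now exists l).
  destruct (Hcont _ (open_gt 0 (f c) Hc)) as [d Hd'].
  exists d. split; [apply cond_pos|]. exact Hd'.
Qed.

(** At the last point before which [f] stays positive, [f] vanishes while coming
    from above, so its derivative there cannot be positive. *)
Lemma upward_zeros_no_descent (f df : R -> R) (s0 s1 : R) :
  s0 < s1 ->
  (forall s, s0 <= s <= s1 -> is_derive f s (df s)) ->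
  (forall s, s0 <= s <= s1 -> f s = 0 -> 0 < df s) ->
  0 < f s0 -> 0 <= f s1.
Proof.
  intros Hlt Hd Hz H0.
  destruct (Rle_or_lt 0 (f s1)) as [|H1]; [assumption|exfalso].
  set (E := fun x => s0 <= x <= s1 /\ forall y, s0 <= y <= x -> 0 < f y).
  destruct (completeness E) as [c [Hub Hlub]].
  { exists s1. intros x [Hx _]. lra. }
  { exists s0. split; [lra|]. intros y Hy. now replace y with s0 by lra. }
  assert (Hc0 : s0 <= c).
  { apply Hub. split; [lra|]. intros y Hy. now replace y with s0 by lra. }
  assert (Hc1 : c <= s1).
  { apply Hlub. intros x [Hx _]. lra. }
  assert (Hbelow : forall y, s0 <= y < c -> 0 < f y).
  { intros y Hy. destruct (Rle_or_lt (f y) 0) as [Hy0|]; [exfalso|assumption].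
    assert (c <= y); [|lra]. apply Hlub. intros x [Hx Hx'].
    destruct (Rle_or_lt x y) as [|Hxy]; [assumption|].
    specialize (Hx' y). lra. }
  destruct (Rtotal_order (f c) 0) as [Hn|[Hn|Hn]].
  - destruct (is_derive_pos_locally (fun x => - f x) c (- df c)) as [d [Hdp Hd']].
    + apply (is_derive_opp f). apply Hd. lra.
    + lra.
    + assert (Hs : s0 < c) by (destruct (Req_dec c s0); [subst; lra|lra]).
      assert (Hm : exists y, s0 <= y < c /\ c - d < y).
      { exists (Rmax s0 (c - d / 2)). unfold Rmax. destruct Rle_dec; lra. }
      destruct Hm as [y [Hy Hy']].
      specialize (Hbelow y Hy).
      assert (Rabs (y - c) < d) by (apply Rabs_def1; lra).
      specialize (Hd' y H). simpl in Hd'. lra.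
  - destruct (is_derive_pos_below f c (df c)) as [d [Hdp Hd']]; auto.
    assert (Hs : s0 < c) by (destruct (Req_dec c s0); [subst; lra|lra]).
    assert (Hm : exists y, s0 <= y < c /\ c - d < y).
    { exists (Rmax s0 (c - d / 2)). unfold Rmax. destruct Rle_dec; lra. }
    destruct Hm as [y [Hy Hy']].
    specialize (Hbelow y Hy). specialize (Hd' y). lra.
  - assert (Hs : c < s1) by (destruct (Req_dec c s1); [subst; lra|lra]).
    destruct (is_derive_pos_locally f c (df c)) as [d [Hdp Hd']].
    { apply Hd; lra. } { assumption. }
    assert (Hm : exists x, c < x <= s1 /\ x < c + d).
    { exists (Rmin s1 (c + d / 2)). unfold Rmin. destruct Rle_dec; lra. }
    destruct Hm as [x [Hx Hx']].
    assert (x <= c); [|lra]. apply Hub. split; [lra|].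
    intros y Hy. destruct (Rle_or_lt c y).
    + apply Hd'. apply Rabs_def1; lra.
    + apply Hbelow; lra.
Qed.

(** The heart of the theorem. Read [(C, S) = (cos theta, sin theta)] and
    [K = theta']. Where [C = y] one has [S = +- sqrt (1 - y^2)], and if
    [2 |h y| <= |S|] then, because the coefficient [k] is larger than 1, the sign
    of [theta'] is forced to be opposite to that of [S]; hence
    [C' = - S theta' > 0] at every point where [C = y], and [C] can never cross the
    level [y] downwards. *)
Lemma circle_barrier (h C S K : R -> R) (y s0 s1 : R) :
  (forall s, s0 <= s <= s1 ->
     C s ^ 2 + S s ^ 2 = 1 /\ is_derive C s (- S s * K s)) ->
  (forall s, s0 <= s <= s1 ->
     exists w k, 0 < w /\ 1 < k /\ K s = w * (2 * h (C s) - k * S s)) ->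
  s0 < s1 -> y < C s0 -> C s1 < y -> -1 < y < 1 ->
  sqrt (1 - y ^ 2) < 2 * Rabs (h y).
Proof.
  intros HC HK Hs H0 H1 Hy.
  assert (Hm : 0 < 1 - y ^ 2) by nra.
  assert (Em := pow2_sqrt (1 - y ^ 2) ltac:(lra)).
  assert (Pm := sqrt_lt_R0 _ Hm).
  set (m := sqrt (1 - y ^ 2)) in *. clearbody m.
  destruct (Rlt_or_le m (2 * Rabs (h y))) as [|Hle]; [assumption|exfalso].
  assert (0 <= C s1 - y); [|lra].
  apply (upward_zeros_no_descent (fun s => C s - y) (fun s => - S s * K s) s0 s1);
    try lra.
  - intros s Hss. destruct (HC s Hss) as [_ Hd]. auto_derive; [eexists; exact Hd|].
    rewrite Rmult_1_l. now apply is_derive_unique.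
  - intros s Hss Hz. destruct (HC s Hss) as [E _].
    destruct (HK s Hss) as (w & k & Hw & Hk & ->).
    assert (ES : S s ^ 2 = m ^ 2) by (replace (C s) with y in E by lra; lra).
    replace (C s) with y by lra.
    assert (Hle' : 2 * h y * S s <= m ^ 2).
    { apply Rle_trans with (Rabs (2 * h y * S s)); [apply Rle_abs|].
      assert (EA : Rabs (S s) = m).
      { rewrite <- (Rabs_right m) by lra. apply Rsqr_eq_abs_0. unfold Rsqr. lra. }
      rewrite !Rabs_mult, EA, (Rabs_right 2) by lra. nra. }
    replace (- S s * (w * (2 * h y - k * S s)))
      with (w * (k * S s ^ 2 - 2 * h y * S s)) by ring.
    apply Rmult_lt_0_compat; [assumption|]. rewrite ES. nra.
Qed.

Lemma C1_on_linear_bound (H dH : R -> R) (a b x : R) :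
  C1_on a b H dH -> a <= x <= b -> H x = 0 ->
  exists M d, 0 < M /\ 0 < d /\
    forall y, a <= y <= b -> Rabs (y - x) < d -> Rabs (H y) <= M * Rabs (y - x).
Proof.
  intros HC Hx H0. destruct (HC x Hx) as [[_ Hd] _].
  specialize (Hd x).
  assert (Hlim : is_filter_lim (within (fun y => a <= y <= b) (locally x)) x).
  { intros P HP. unfold within. eapply filter_imp; [|exact HP]. auto. }
  destruct (Hd Hlim (mkposreal 1 Rlt_0_1)) as [d Hd'].
  exists (1 + Rabs (dH x)), d. split; [|split].
  - assert (T := Rabs_pos (dH x)). lra.
  - apply cond_pos.
  - intros y Hy Hyd. specialize (Hd' y Hyd Hy).
    change (Rabs (H y - H x - (y - x) * dH x) <= 1 * Rabs (y - x)) in Hd'.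
    rewrite H0 in Hd'.
    replace (H y) with ((H y - 0 - (y - x) * dH x) + (y - x) * dH x) by ring.
    eapply Rle_trans; [apply Rabs_triang|]. rewrite Rabs_mult. lra.
Qed.

(** Near [x = +- 1] the lower bound [sqrt (1 - y^2)] is of order
    [sqrt |y - x|], whereas a differentiable function vanishing at [x] is
    [O(|y - x|)]. *)
Lemma endpoint_nonzero (H : R -> R) (x : R) :
  C1_function H -> x ^ 2 = 1 ->
  (forall y, -1 < y < 1 -> sqrt (1 - y ^ 2) < 2 * Rabs (H y)) -> H x <> 0.
Proof.
  intros [dH HC] Hx Hb H0.
  assert (Hx1 : -1 <= x <= 1) by nra.
  destruct (C1_on_linear_bound H dH (-1) 1 x HC Hx1 H0) as (M & d & HM & Hd & Hbd).
  (* At distance t from x the two bounds would give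
     t (2 - t) < 4 M^2 t^2 <= t / 2, which fails for t <= 1 / 2. *)
  set (t := Rmin (1 / 2) (Rmin (d / 2) (1 / (8 * M ^ 2)))).
  assert (HM2 : 0 < M ^ 2) by nra.
  assert (Ht : 0 < t).
  { unfold t. repeat apply Rmin_glb_lt; try lra.
    apply Rdiv_lt_0_compat; lra. }
  assert (Ht1 : t <= 1 / 2) by apply Rmin_l.
  assert (Ht2 : t <= d / 2) by (eapply Rle_trans; [apply Rmin_r|apply Rmin_l]).
  assert (Ht3 : t * (8 * M ^ 2) <= 1).
  { apply Rle_trans with (1 / (8 * M ^ 2) * (8 * M ^ 2)).
    - apply Rmult_le_compat_r; [lra|]. eapply Rle_trans; [apply Rmin_r|apply Rmin_r].
    - right. field. lra. }
  clearbody t.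
  assert (Hx2 : x = 1 \/ x = -1).
  { assert (T : (x - 1) * (x + 1) = 0) by nra.
    apply Rmult_integral in T. lra. }
  set (y := x * (1 - t)).
  assert (Hy : -1 < y < 1) by (unfold y; nra).
  assert (Hyx : Rabs (y - x) = t).
  { unfold y. destruct Hx2; subst x.
    - rewrite Rabs_left; lra.
    - rewrite Rabs_right; lra. }
  assert (B1 := Hb y Hy).
  assert (B2 := Hbd y ltac:(lra) ltac:(lra)). rewrite Hyx in B2.
  assert (Ey : 1 - y ^ 2 = t * (2 - t)) by (unfold y; nra).
  rewrite Ey in B1.
  assert (Esq := pow2_sqrt (t * (2 - t)) ltac:(nra)).
  assert (Pq := sqrt_pos (t * (2 - t))).
  set (q := sqrt (t * (2 - t))) in *.
  assert (q < 2 * (M * t)) by lra.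
  assert (q ^ 2 < (2 * (M * t)) ^ 2) by nra.
  nra.
Qed.

Lemma nonvanishing_pos (f : R -> R) (a b x y : R) :
  (forall s, a < s < b -> continuity_pt f s) ->
  (forall s, a < s < b -> f s <> 0) ->
  a < x < b -> a < y < b -> 0 < f x -> 0 < f y.
Proof.
  intros Hc Hn Hx Hy Hfx.
  destruct (Rtotal_order (f y) 0) as [Hfy|[Hfy|Hfy]]; [exfalso|now apply Hn in Hfy|assumption].
  destruct (Rtotal_order x y) as [Hxy|[Hxy|Hxy]]; [|subst; lra|].
  - destruct (Ranalysis5.IVT_interv (fun s => - f s) x y) as (z & Hz & E); try lra.
    + intros s Hs. apply continuity_pt_opp, Hc. lra.
    + apply (Hn z); lra.
  - destruct (Ranalysis5.IVT_interv f y x) as (z & Hz & E); try lra.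
    + intros s Hs. apply Hc. lra.
    + apply (Hn z); lra.
Qed.

Lemma nonvanishing_sign (f : R -> R) (a b : R) : a < b ->
  (forall s, a < s < b -> continuity_pt f s) ->
  (forall s, a < s < b -> f s <> 0) ->
  (forall s, a < s < b -> 0 < f s) \/ (forall s, a < s < b -> 0 < - f s).
Proof.
  intros Hab Hc Hn.
  destruct (Rtotal_order (f ((a + b) / 2)) 0) as [Hf|[Hf|Hf]].
  - right. intros s Hs.
    apply (nonvanishing_pos (fun s => - f s) a b ((a + b) / 2)); try lra.
    + intros t Ht. now apply continuity_pt_opp, Hc.
    + intros t Ht E. apply (Hn t Ht). lra.
  - exfalso. apply (Hn ((a + b) / 2)); lra.
  - left. intros s Hs. apply (nonvanishing_pos f a b ((a + b) / 2)); auto; lra.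
Qed.

(** * The equations of a rotational meridian *)

(** The hyperbolic cosine of a length, as a function of its hyperbolic sine. *)
Definition ch (x : R) : R := sqrt (1 + x ^ 2).

Lemma ch_pos x : 0 < ch x.
Proof. apply sqrt_lt_R0. assert (T := pow2_ge_0 x). lra. Qed.
Lemma ch_sq x : ch x ^ 2 = 1 + x ^ 2.
Proof. apply pow2_sqrt. assert (T := pow2_ge_0 x). lra. Qed.
Lemma ch_opp x : ch (- x) = ch x.
Proof. unfold ch. f_equal. ring. Qed.

Lemma is_derive_ch (r : R -> R) (s r' : R) :
  is_derive r s r' -> is_derive (fun x => ch (r x)) s (r s * r' / ch (r s)).
Proof.
  intros Hr. assert (T := pow2_ge_0 (r s)). assert (Pc := ch_pos (r s)).
  unfold ch in *. simpl in T, Pc. auto_derive.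
  - split; [eexists; eassumption|]. split; [lra|trivial].
  - replace (Derive (fun x => r x) s) with r' by (symmetry; now apply is_derive_unique).
    simpl. field. lra.
Qed.

Lemma ch_sinh t : ch (sinh t) = cosh t.
Proof.
  unfold ch.
  replace (1 + sinh t ^ 2) with (cosh t ^ 2).
  - apply sqrt_pow2. unfold cosh. assert (T := exp_pos t). assert (T' := exp_pos (- t)). lra.
  - unfold cosh, sinh. assert (T : exp t * exp (- t) = 1).
    { rewrite <- exp_plus, Rplus_opp_r. apply exp_0. }
    transitivity (exp t * exp (- t) + ((exp t - exp (- t)) / 2) ^ 2);
      [field|now rewrite T].
Qed.

(** The meridian is [s |-> (rho s, z s)], where [rho] is the signed distance to the
    axis; [r1], [r2] and [z1], [z2] are the first two derivatives of [r] and of the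
    height. The coordinate [r = sinh rho] is used instead of [rho], being a linear
    function of the point of the hyperboloid; then [ch r = cosh rho],
    [rho' = r1 / ch r], [rho'' = (r2 - r * rho'^2) / ch r] and [coth rho = ch r / r].
    The unit normal is [beta / ch r] times the horizontal radial unit vector plus
    [n] times the vertical one, so that [n] is the angle function.
    In [pr_mean] the two terms on the left are the principal curvatures of the
    meridian and of the parallels. At the poles only the values of [r] and
    [beta] are recorded, which make sense although the equation degenerates
    there. *)
Record profile (h r r1 r2 z1 z2 beta n : R -> R) : Prop := {
  pr_r : forall s, is_derive r s (r1 s);
  pr_r1 : forall s, is_derive r1 s (r2 s);
  pr_z1 : forall s, is_derive z1 s (z2 s);
  pr_beta : forall s, continuity_pt beta s;
  pr_n : forall s, continuity_pt n s;
  pr_axis0 : r 0 = 0;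
  pr_axis1 : r PI = 0;
  pr_pole0 : beta 0 = 0;
  pr_pole1 : beta PI = 0;
  pr_ne : forall s, 0 < s < PI -> r s <> 0;
  pr_reg : forall s, 0 < s < PI -> 0 < (r1 s / ch (r s)) ^ 2 + z1 s ^ 2;
  pr_unit : forall s, 0 < s < PI -> (beta s / ch (r s)) ^ 2 + n s ^ 2 = 1;
  pr_orth : forall s, 0 < s < PI -> r1 s / ch (r s) * (beta s / ch (r s)) + z1 s * n s = 0;
  pr_mean : forall s, 0 < s < PI ->
    ((r2 s - r s * (r1 s / ch (r s)) ^ 2) / ch (r s) * (beta s / ch (r s)) + z2 s * n s)
      / ((r1 s / ch (r s)) ^ 2 + z1 s ^ 2) - beta s / r s = 2 * h (n s)
}.

(** Reversing the radial direction reduces the proof to the case [r > 0]. *)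
Lemma profile_flip_axis h r r1 r2 z1 z2 beta n :
  profile h r r1 r2 z1 z2 beta n ->
  profile h (fun s => - r s) (fun s => - r1 s) (fun s => - r2 s) z1 z2
    (fun s => - beta s) n.
Proof.
  intros [Hr Hr1 Hz1 Hb Hn A0 A1 B0 B1 Hne Hreg Hu Ho Hm].
  split; auto;
    try (intros s Hs; match type of Hs with _ < _ < _ => idtac end;
         rewrite ?ch_opp; assert (Pc := ch_pos (r s))).
  - intros s. now apply (is_derive_opp r).
  - intros s. now apply (is_derive_opp r1).
  - intros s. now apply continuity_pt_opp.
  - lra.
  - lra.
  - lra.
  - lra.
  - specialize (Hne s Hs). lra.
  - replace ((- r1 s / ch (r s)) ^ 2) with ((r1 s / ch (r s)) ^ 2) by (field; lra). auto.
  - rewrite <- (Hu s Hs). field. lra.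
  - rewrite <- (Ho s Hs). field. lra.
  - assert (Nr := Hne s Hs). assert (Re := Hreg s Hs).
    rewrite <- (Hm s Hs).
    replace ((- r1 s / ch (r s)) ^ 2) with ((r1 s / ch (r s)) ^ 2) by (field; lra).
    set (E := (r1 s / ch (r s)) ^ 2 + z1 s ^ 2) in *.
    set (Q := (r1 s / ch (r s)) ^ 2) in *. clearbody E Q. field. repeat split; lra.
Qed.

(** Changing the sign of the normal replaces [h] by [y |-> - h (- y)], and the
    bound to be proved is invariant under this change, so either orientation may
    be chosen. *)
Lemma profile_flip_normal h r r1 r2 z1 z2 beta n :
  profile h r r1 r2 z1 z2 beta n ->
  profile (fun y => - h (- y)) r r1 r2 z1 z2 (fun s => - beta s) (fun s => - n s).
Proof.
  intros [Hr Hr1 Hz1 Hb Hn A0 A1 B0 B1 Hne Hreg Hu Ho Hm].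
  split; auto;
    try (intros s Hs; match type of Hs with _ < _ < _ => idtac end;
         assert (Pc := ch_pos (r s))).
  - intros s. now apply continuity_pt_opp.
  - intros s. now apply continuity_pt_opp.
  - lra.
  - lra.
  - rewrite <- (Hu s Hs). field. lra.
  - transitivity (- (r1 s / ch (r s) * (beta s / ch (r s)) + z1 s * n s));
      [field; lra|rewrite (Ho s Hs); ring].
  - assert (Nr := Hne s Hs). assert (Re := Hreg s Hs). rewrite Ropp_involutive.
    replace (2 * - h (n s)) with (- (2 * h (n s))) by ring.
    rewrite <- (Hm s Hs).
    set (E := (r1 s / ch (r s)) ^ 2 + z1 s ^ 2) in *.
    set (Q := (r1 s / ch (r s)) ^ 2) in *. clearbody E Q. field. repeat split; lra.
Qed.

(** The meridian leaves the axis at one pole and comes back at the other: by the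
    mean value theorem the distance to the axis increases somewhere near the
    first pole and decreases somewhere near the second. *)
Lemma slope_near_axis h r r1 r2 z1 z2 beta n :
  profile h r r1 r2 z1 z2 beta n -> (forall s, 0 < s < PI -> 0 < r s) ->
  forall d, 0 < d -> d <= PI / 2 ->
  (exists s, 0 < s < d /\ 0 < r1 s) /\ (exists s, PI - d < s < PI /\ r1 s < 0).
Proof.
  intros HP Hpos d Hd Hd'. split.
  - destruct (MVT_cor2 r r1 0 (d / 2)) as (s & E & Hs); [lra| |].
    { intros c _. apply is_derive_Reals. apply HP. }
    exists s. split; [lra|]. rewrite (pr_axis0 _ _ _ _ _ _ _ _ HP) in E.
    assert (T := Hpos (d / 2) ltac:(lra)). nra.
  - destruct (MVT_cor2 r r1 (PI - d / 2) PI) as (s & E & Hs); [lra| |].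
    { intros c _. apply is_derive_Reals. apply HP. }
    exists s. split; [lra|]. rewrite (pr_axis1 _ _ _ _ _ _ _ _ HP) in E.
    assert (T := Hpos (PI - d / 2) ltac:(lra)). nra.
Qed.

Lemma continuity_pt_near (f : R -> R) x eps :
  continuity_pt f x -> f x = 0 -> 0 < eps ->
  exists d, 0 < d /\ forall y, Rabs (y - x) < d -> Rabs (f y) < eps.
Proof.
  intros Hc H0 He.
  destruct (proj1 (continuity_pt_locally f x) Hc (mkposreal eps He)) as [d Hd].
  exists d. split; [apply cond_pos|]. intros y Hy. specialize (Hd y Hy).
  simpl in Hd. now rewrite H0, Rminus_0_r in Hd.
Qed.

(** With [r > 0] and the normal suitably oriented, the unit tangent of the
    meridian is [(C, S) = (n, - beta / ch r)], and [pr_mean] becomes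
    [theta' = w (2 h (cos theta) - coth rho * sin theta)], with [w] the speed.
    Since [coth rho > 1], [circle_barrier] applies. Near the poles [beta], hence
    [S], is small, so that [C] is close to [1] where [rho' > 0] and to [-1] where
    [rho' < 0]: the level [y] is crossed downwards. *)
Lemma profile_oriented_bound h r r1 r2 z1 z2 beta n y :
  profile h r r1 r2 z1 z2 beta n -> (forall s, 0 < s < PI -> 0 < r s) ->
  (forall s, 0 < s < PI -> 0 < r1 s / ch (r s) * n s - z1 s * (beta s / ch (r s))) ->
  -1 < y < 1 -> sqrt (1 - y ^ 2) < 2 * Rabs (h y).
Proof.
  intros HP Hpos Hor Hy.
  set (P := fun s => r1 s / ch (r s)).
  set (P' := fun s => (r2 s - r s * P s ^ 2) / ch (r s)).
  set (w := fun s => sqrt (P s ^ 2 + z1 s ^ 2)).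
  set (C := fun s => P s / w s). set (S := fun s => z1 s / w s).
  set (K := fun s => (P s * z2 s - z1 s * P' s) / w s ^ 2).
  assert (Hw : forall s, 0 < s < PI -> 0 < w s).
  { intros s Hs. apply sqrt_lt_R0. now apply HP. }
  assert (Hw2 : forall s, 0 < s < PI -> w s ^ 2 = P s ^ 2 + z1 s ^ 2).
  { intros s Hs. apply pow2_sqrt. left. now apply HP. }
  (* The vectors (P, z1) and (beta / ch r, n) are orthogonal in the plane and the
     second is a unit vector, so it is a quarter turn of (P, z1) / w; the
     orientation decides which one. *)
  assert (Hcs : forall s, 0 < s < PI -> n s = C s /\ beta s / ch (r s) = - S s).
  { intros s Hs. assert (Pw := Hw s Hs). assert (Ew := Hw2 s Hs).
    assert (U := pr_unit _ _ _ _ _ _ _ _ HP s Hs).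
    assert (O := pr_orth _ _ _ _ _ _ _ _ HP s Hs).
    assert (T := Hor s Hs). fold (P s) in T, O.
    set (b := beta s / ch (r s)) in *. clearbody b.
    assert (Es : P s * n s - z1 s * b = w s).
    { apply Rsqr_inj; [lra|lra|]. unfold Rsqr.
      transitivity ((P s ^ 2 + z1 s ^ 2) * (b ^ 2 + n s ^ 2) - (P s * b + z1 s * n s) ^ 2);
        [ring|]. rewrite O, U, <- Ew. ring. }
    unfold C, S. split; apply (Rmult_eq_reg_r (w s ^ 2)); try nra.
    - transitivity (P s * w s); [|field; lra]. rewrite Ew, <- Es.
      transitivity (P s * (P s * n s - z1 s * b) + z1 s * (P s * b + z1 s * n s));
        [ring|]. rewrite O. ring.
    - transitivity (- z1 s * w s); [|field; lra]. rewrite Ew, <- Es.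
      transitivity (- z1 s * (P s * n s - z1 s * b) + P s * (P s * b + z1 s * n s));
        [ring|]. rewrite O. ring. }
  assert (HSb : forall s, 0 < s < PI -> Rabs (S s) <= Rabs (beta s)).
  { intros s Hs. destruct (Hcs s Hs) as [_ E].
    rewrite <- (Rabs_Ropp (S s)), <- E.
    assert (Pc := ch_pos (r s)). assert (Qc := ch_sq (r s)).
    assert (1 <= ch (r s)) by (assert (T := pow2_ge_0 (r s)); nra).
    unfold Rdiv. rewrite Rabs_mult, (Rabs_right (/ ch (r s))).
    - rewrite <- (Rmult_1_r (Rabs (beta s))) at 2.
      apply Rmult_le_compat_l; [apply Rabs_pos|].
      rewrite <- Rinv_1. apply Rinv_le_contravar; lra.
    - apply Rle_ge. left. now apply Rinv_0_lt_compat. }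
  assert (Hunit : forall s, 0 < s < PI -> C s ^ 2 + S s ^ 2 = 1).
  { intros s Hs. destruct (Hcs s Hs) as [E1 E2].
    rewrite <- (pr_unit _ _ _ _ _ _ _ _ HP s Hs), E1, E2. ring. }
  destruct (continuity_pt_near beta 0 (sqrt (1 - y ^ 2))) as (d0 & Hd0 & B0);
    [apply HP|apply HP|apply sqrt_lt_R0; nra|].
  destruct (continuity_pt_near beta PI (sqrt (1 - y ^ 2))) as (d1 & Hd1 & B1);
    [apply HP|apply HP|apply sqrt_lt_R0; nra|].
  assert (HPI := PI_RGT_0).
  set (d := Rmin (PI / 2) (Rmin d0 d1)).
  assert (Hd : 0 < d) by (unfold d; repeat apply Rmin_glb_lt; lra).
  assert (Hda : d <= PI / 2) by apply Rmin_l.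
  assert (Hdb : d <= d0) by (eapply Rle_trans; [apply Rmin_r|apply Rmin_l]).
  assert (Hdc : d <= d1) by (eapply Rle_trans; [apply Rmin_r|apply Rmin_r]).
  clearbody d.
  destruct (slope_near_axis _ _ _ _ _ _ _ _ HP Hpos d Hd Hda)
    as [(s0 & Hs0 & R0) (s1 & Hs1 & R1)].
  assert (Hsmall : forall s, 0 < s < PI -> Rabs (beta s) < sqrt (1 - y ^ 2) -> y ^ 2 < C s ^ 2).
  { intros s Hs Hb. assert (U := Hunit s Hs). assert (Hb' := HSb s Hs).
    assert (E := pow2_sqrt (1 - y ^ 2) ltac:(nra)).
    assert (Rabs (S s) ^ 2 < sqrt (1 - y ^ 2) ^ 2).
    { assert (T := Rabs_pos (S s)). nra. }
    rewrite <- Rsqr_pow2, <- Rsqr_abs, Rsqr_pow2 in H. lra. }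
  apply (circle_barrier h C S K y s0 s1).
  - intros s Hs. split; [apply Hunit; lra|].
    assert (Hs' : 0 < s < PI) by lra.
    assert (Pw := Hw s Hs'). assert (Pc := ch_pos (r s)).
    assert (Dr := pr_r _ _ _ _ _ _ _ _ HP s).
    assert (Dr1 := pr_r1 _ _ _ _ _ _ _ _ HP s).
    assert (Dz1 := pr_z1 _ _ _ _ _ _ _ _ HP s).
    assert (DP : is_derive P s (P' s)).
    { unfold P', P. unfold ch in *. auto_derive.
      - assert (T := pow2_ge_0 (r s)). simpl in T, Pc.
        repeat split; try (eexists; eassumption); lra.
      - replace (Derive (fun x => r x) s) with (r1 s)
          by (symmetry; now apply is_derive_unique).
        replace (Derive (fun x => r1 x) s) with (r2 s)
          by (symmetry; now apply is_derive_unique).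
        simpl. field. simpl in Pc. lra. }
    unfold C, S, K, w. auto_derive.
    + repeat split; try (eexists; eassumption).
      * assert (T := pr_reg _ _ _ _ _ _ _ _ HP s Hs'). fold (P s) in T. simpl in T. lra.
      * unfold w in Pw. simpl in Pw. lra.
    + replace (Derive (fun x => P x) s) with (P' s)
        by (symmetry; now apply is_derive_unique).
      replace (Derive (fun x => z1 x) s) with (z2 s)
        by (symmetry; now apply is_derive_unique).
      assert (Ew := Hw2 s Hs').
      change (P s * (P s * 1) + z1 s * (z1 s * 1)) with (P s ^ 2 + z1 s ^ 2).
      fold (w s).
      set (W := w s) in *. clearbody W.
      apply (Rmult_eq_reg_r (W ^ 3)); [|apply pow_nonzero; lra].
      transitivity (P' s * W ^ 2 - P s * (P s * P' s + z1 s * z2 s)); [field; lra|].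
      transitivity (- z1 s * (P s * z2 s - z1 s * P' s)); [rewrite Ew; ring|field; lra].
  - intros s Hs. assert (Hs' : 0 < s < PI) by lra.
    assert (Pw := Hw s Hs'). assert (Pc := ch_pos (r s)). assert (Pr := Hpos s Hs').
    exists (w s), (ch (r s) / r s). split; [assumption|]. split.
    + apply (Rmult_lt_reg_r (r s)); [assumption|].
      replace (ch (r s) / r s * r s) with (ch (r s)) by (field; lra).
      assert (Q := ch_sq (r s)). nra.
    + destruct (Hcs s Hs') as [E1 E2].
      assert (M := pr_mean _ _ _ _ _ _ _ _ HP s Hs').
      fold (P s) in M. fold (P' s) in M. rewrite <- (Hw2 s Hs') in M.
      assert (E3 : beta s = - S s * ch (r s)) by (rewrite <- E2; field; lra).
      rewrite E2, E1, E3 in M. rewrite <- M. unfold C, S, K. field. split; lra.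
  - lra.
  - assert (HC : y ^ 2 < C s0 ^ 2).
    { apply Hsmall; [lra|]. apply B0. rewrite Rabs_right; lra. }
    assert (0 < C s0); [|nra].
    unfold C, P. assert (Pc := ch_pos (r s0)). assert (Pw := Hw s0 ltac:(lra)).
    repeat apply Rdiv_lt_0_compat; assumption.
  - assert (HC : y ^ 2 < C s1 ^ 2).
    { apply Hsmall; [lra|]. apply B1. rewrite Rabs_left; lra. }
    assert (0 < - C s1); [|nra].
    unfold C, P. assert (Pc := ch_pos (r s1)). assert (Pw := Hw s1 ltac:(lra)).
    replace (- (r1 s1 / ch (r s1) / w s1)) with (- r1 s1 / ch (r s1) / w s1) by (field; lra).
    repeat apply Rdiv_lt_0_compat; lra.
  - assumption.
Qed.

Lemma profile_bound h r r1 r2 z1 z2 beta n y :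
  profile h r r1 r2 z1 z2 beta n ->
  -1 < y < 1 -> sqrt (1 - y ^ 2) < 2 * Rabs (h y).
Proof.
  assert (HPI := PI_RGT_0).
  assert (Pos : forall h r r1 r2 z1 z2 beta n y, profile h r r1 r2 z1 z2 beta n ->
    (forall s, 0 < s < PI -> 0 < r s) -> -1 < y < 1 -> sqrt (1 - y ^ 2) < 2 * Rabs (h y)).
  { clear h r r1 r2 z1 z2 beta n y. intros h r r1 r2 z1 z2 beta n y HP Hpos Hy.
    (* W is the scalar product of the velocity with the normal rotated by a quarter
       turn, hence plus or minus the speed; its constant sign is the orientation. *)
    set (W := fun s => r1 s / ch (r s) * n s - z1 s * (beta s / ch (r s))).
    destruct (nonvanishing_sign W 0 PI HPI) as [HW|HW].
    - intros s _.
      assert (Cd : forall f f1 : R -> R, is_derive f s (f1 s) -> continuity_pt f s).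
      { intros f f1 Hf. apply derivable_continuous_pt. exists (f1 s).
        now apply is_derive_Reals. }
      assert (Dr := pr_r _ _ _ _ _ _ _ _ HP s).
      assert (Cc : continuity_pt (fun s => ch (r s)) s).
      { apply (Cd _ (fun s => r s * r1 s / ch (r s))). now apply is_derive_ch. }
      assert (Nc : ch (r s) <> 0) by (assert (T := ch_pos (r s)); lra).
      apply (continuity_pt_minus (fun s => r1 s / ch (r s) * n s)
        (fun s => z1 s * (beta s / ch (r s)))).
      + apply (continuity_pt_mult (fun s => r1 s / ch (r s)) n); [|apply HP].
        apply (continuity_pt_div r1 (fun s => ch (r s))); auto.
        apply (Cd _ r2). apply HP.
      + apply (continuity_pt_mult z1 (fun s => beta s / ch (r s))).
        * apply (Cd _ z2). apply HP.
        * apply (continuity_pt_div beta (fun s => ch (r s))); auto. apply HP.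
    - intros s Hs E. unfold W in E.
      assert (U := pr_unit _ _ _ _ _ _ _ _ HP s Hs).
      assert (O := pr_orth _ _ _ _ _ _ _ _ HP s Hs).
      assert (G := pr_reg _ _ _ _ _ _ _ _ HP s Hs).
      set (b := beta s / ch (r s)) in *. set (P := r1 s / ch (r s)) in *.
      assert (T : P ^ 2 + z1 s ^ 2 = (P * n s - z1 s * b) ^ 2 + (P * b + z1 s * n s) ^ 2).
      { transitivity ((P ^ 2 + z1 s ^ 2) * (b ^ 2 + n s ^ 2)); [rewrite U; ring|ring]. }
      rewrite E, O in T. lra.
    - now apply (profile_oriented_bound _ _ _ _ _ _ _ _ _ HP).
    - replace y with (- - y) at 2 by ring. rewrite <- Rabs_Ropp.
      replace (y ^ 2) with ((- y) ^ 2) by ring.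
      apply (profile_oriented_bound _ _ _ _ _ _ _ _ (- y)
        (profile_flip_normal _ _ _ _ _ _ _ _ HP) Hpos); [|lra].
      intros s Hs. specialize (HW s Hs). unfold W in HW.
      assert (Pc := ch_pos (r s)).
      replace (r1 s / ch (r s) * - n s - z1 s * (- beta s / ch (r s)))
        with (- (r1 s / ch (r s) * n s - z1 s * (beta s / ch (r s)))) by (field; lra).
      exact HW. }
  intros HP Hy.
  destruct (nonvanishing_sign r 0 PI HPI) as [Hr|Hr].
  - intros s _. apply derivable_continuous_pt. exists (r1 s).
    apply is_derive_Reals. apply HP.
  - apply HP.
  - now apply (Pos _ _ _ _ _ _ _ _ _ HP).
  - now apply (Pos _ _ _ _ _ _ _ _ _ (profile_flip_axis _ _ _ _ _ _ _ _ HP)).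
Qed.

(** * Lorentz frames *)

(** The shape is that of the horizontal part of [rotation]. *)
Definition comb (p e1 e2 : vec3) (a b c : R) : vec3 :=
  plus (scal a p) (plus (scal b e1) (scal c e2)).

Lemma vec3_ext (v w : vec3) : x0 v = x0 w -> x1 v = x1 w -> x2 v = x2 w -> v = w.
Proof.
  destruct v as [[a b] c], w as [[a' b'] c']; unfold x0, x1, x2; simpl.
  now intros -> -> ->.
Qed.

Lemma comb_x0 p e1 e2 a b c :
  x0 (comb p e1 e2 a b c) = a * x0 p + (b * x0 e1 + c * x0 e2).
Proof. reflexivity. Qed.
Lemma comb_x1 p e1 e2 a b c :
  x1 (comb p e1 e2 a b c) = a * x1 p + (b * x1 e1 + c * x1 e2).
Proof. reflexivity. Qed.
Lemma comb_x2 p e1 e2 a b c :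
  x2 (comb p e1 e2 a b c) = a * x2 p + (b * x2 e1 + c * x2 e2).
Proof. reflexivity. Qed.

Lemma lorentz_comb_r p e1 e2 a b c v :
  lorentz v (comb p e1 e2 a b c) = a * lorentz v p + b * lorentz v e1 + c * lorentz v e2.
Proof. unfold lorentz. rewrite comb_x0, comb_x1, comb_x2. ring. Qed.
Lemma lorentz_comb_l p e1 e2 a b c v :
  lorentz (comb p e1 e2 a b c) v = a * lorentz p v + b * lorentz e1 v + c * lorentz e2 v.
Proof. unfold lorentz. rewrite comb_x0, comb_x1, comb_x2. ring. Qed.
Lemma lorentz_sym v w : lorentz v w = lorentz w v.
Proof. unfold lorentz. ring. Qed.

Lemma lorentz_comb p e1 e2 a b c a' b' c' : frame p e1 e2 ->
  lorentz (comb p e1 e2 a b c) (comb p e1 e2 a' b' c') = - (a * a') + b * b' + c * c'.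
Proof.
  intros ([Hp _] & H1 & H2 & H3 & H4 & H5).
  rewrite lorentz_comb_l, !lorentz_comb_r.
  rewrite (lorentz_sym e1 p), (lorentz_sym e2 p), (lorentz_sym e2 e1), Hp, H1, H2, H3, H4, H5.
  ring.
Qed.

Definition det3 (p e f : vec3) : R :=
  x0 p * (x1 e * x2 f - x2 e * x1 f)
  - x1 p * (x0 e * x2 f - x2 e * x0 f)
  + x2 p * (x0 e * x1 f - x1 e * x0 f).

(** The square of the determinant is, up to sign, the Gram determinant. *)
Lemma frame_det3 p e1 e2 : frame p e1 e2 -> det3 p e1 e2 <> 0.
Proof.
  intros ([Hp _] & H1 & H2 & H3 & H4 & H5) H0.
  assert (G : - det3 p e1 e2 ^ 2 =
    lorentz p p * (lorentz e1 e1 * lorentz e2 e2 - lorentz e1 e2 ^ 2)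
    - lorentz p e1 * (lorentz p e1 * lorentz e2 e2 - lorentz e1 e2 * lorentz p e2)
    + lorentz p e2 * (lorentz p e1 * lorentz e1 e2 - lorentz e1 e1 * lorentz p e2)).
  { unfold det3, lorentz. ring. }
  rewrite H0, Hp, H1, H2, H3, H4, H5 in G. lra.
Qed.

(** Cramer's rule for the system formed by the three orthogonality relations. *)
Lemma frame_orthogonal_zero p e1 e2 (v : vec3) :
  frame p e1 e2 -> lorentz v p = 0 -> lorentz v e1 = 0 -> lorentz v e2 = 0 ->
  x0 v = 0 /\ x1 v = 0 /\ x2 v = 0.
Proof.
  intros Hf Vp V1 V2. assert (D := frame_det3 _ _ _ Hf).
  assert (K : forall x, x * det3 p e1 e2 = 0 -> x = 0).
  { intros x Hx. apply Rmult_integral in Hx. tauto. }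
  repeat split; apply K.
  - transitivity (- (lorentz v p * (x1 e1 * x2 e2 - x2 e1 * x1 e2)
      - lorentz v e1 * (x1 p * x2 e2 - x2 p * x1 e2)
      + lorentz v e2 * (x1 p * x2 e1 - x2 p * x1 e1))).
    + unfold det3, lorentz. ring.
    + rewrite Vp, V1, V2. ring.
  - transitivity (- (lorentz v p * (x0 e1 * x2 e2 - x2 e1 * x0 e2)
      - lorentz v e1 * (x0 p * x2 e2 - x2 p * x0 e2)
      + lorentz v e2 * (x0 p * x2 e1 - x2 p * x0 e1))).
    + unfold det3, lorentz. ring.
    + rewrite Vp, V1, V2. ring.
  - transitivity (lorentz v p * (x0 e1 * x1 e2 - x1 e1 * x0 e2)
      - lorentz v e1 * (x0 p * x1 e2 - x1 p * x0 e2)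
      + lorentz v e2 * (x0 p * x1 e1 - x1 p * x0 e1)).
    + unfold det3, lorentz. ring.
    + rewrite Vp, V1, V2. ring.
Qed.

(** A Lorentz-orthonormal triple is a basis; the sign of the first coefficient
    comes from [<p, p> = -1]. *)
Lemma frame_expand p e1 e2 v : frame p e1 e2 ->
  v = comb p e1 e2 (- lorentz v p) (lorentz v e1) (lorentz v e2).
Proof.
  intros Hf. set (w := comb p e1 e2 _ _ _).
  set (d := (x0 v - x0 w, x1 v - x1 w, x2 v - x2 w) : vec3).
  assert (E : forall q, lorentz d q = lorentz v q - lorentz w q).
  { intros q. unfold d, lorentz, x0, x1, x2. simpl. ring. }
  destruct (frame_orthogonal_zero p e1 e2 d Hf) as (D0 & D1 & D2).
  1-3: destruct Hf as ([Hp _] & H1 & H2 & H3 & H4 & H5);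
    rewrite E; unfold w; rewrite lorentz_comb_l;
    rewrite ?(lorentz_sym e1 p), ?(lorentz_sym e2 p), ?(lorentz_sym e2 e1);
    rewrite ?Hp, ?H1, ?H2, ?H3, ?H4, ?H5; ring.
  change (x0 v - x0 w = 0) in D0. change (x1 v - x1 w = 0) in D1.
  change (x2 v - x2 w = 0) in D2.
  apply vec3_ext; lra.
Qed.

Lemma lorentz_comb_p p e1 e2 a b c : frame p e1 e2 ->
  lorentz (comb p e1 e2 a b c) p = - a.
Proof.
  intros ([Hp _] & H1 & H2 & _). rewrite lorentz_comb_l.
  rewrite (lorentz_sym e1), (lorentz_sym e2), Hp, H1, H2. ring.
Qed.
Lemma lorentz_comb_e1 p e1 e2 a b c : frame p e1 e2 ->
  lorentz (comb p e1 e2 a b c) e1 = b.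
Proof.
  intros (_ & H1 & _ & H3 & _ & H5). rewrite lorentz_comb_l.
  rewrite (lorentz_sym e2), H1, H3, H5. ring.
Qed.
Lemma lorentz_comb_e2 p e1 e2 a b c : frame p e1 e2 ->
  lorentz (comb p e1 e2 a b c) e2 = c.
Proof.
  intros (_ & _ & H2 & _ & H4 & H5). rewrite lorentz_comb_l.
  rewrite H2, H4, H5. ring.
Qed.

Lemma metric_comb p e1 e2 a b c d a' b' c' d' : frame p e1 e2 ->
  metric (comb p e1 e2 a b c, d) (comb p e1 e2 a' b' c', d')
  = - (a * a') + b * b' + c * c' + d * d'.
Proof. intros Hf. unfold metric. simpl. now rewrite lorentz_comb. Qed.

Lemma comb_zero p e1 e2 : comb p e1 e2 0 0 0 = zero.
Proof.
  apply vec3_ext; [rewrite comb_x0|rewrite comb_x1|rewrite comb_x2];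
    rewrite !Rmult_0_l, !Rplus_0_l; reflexivity.
Qed.

(** * Derivatives of curves and local charts *)
Definition is_derive3 (f : R -> vec3) (t : R) (l : vec3) : Prop :=
  is_derive (fun s => x0 (f s)) t (x0 l) /\
  is_derive (fun s => x1 (f s)) t (x1 l) /\
  is_derive (fun s => x2 (f s)) t (x2 l).
Definition is_derive4 (f : R -> vec4) (t : R) (l : vec4) : Prop :=
  is_derive3 (fun s => fst (f s)) t (fst l) /\ is_derive (fun s => snd (f s)) t (snd l).

Lemma Derive4_unique f t l : is_derive4 f t l -> Derive4 f t = l.
Proof.
  destruct l as [[[l0 l1] l2] l3]. intros ((H0 & H1 & H2) & H3).
  unfold Derive4, Derive3.
  repeat apply (f_equal2 (@pair _ _)); now apply is_derive_unique.
Qed.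

Lemma is_derive4_ext_loc f g t l :
  locally t (fun s => f s = g s) -> is_derive4 f t l -> is_derive4 g t l.
Proof.
  intros Hl ((H0 & H1 & H2) & H3).
  refine (conj (conj _ (conj _ _)) _); [revert H0|revert H1|revert H2|revert H3];
    apply is_derive_ext_loc; (eapply filter_imp; [|exact Hl]);
    now intros s ->.
Qed.

Lemma is_derive_lin3 (a b c : R -> R) (t a' b' c' x y z : R) :
  is_derive a t a' -> is_derive b t b' -> is_derive c t c' ->
  is_derive (fun s => a s * x + (b s * y + c s * z)) t (a' * x + (b' * y + c' * z)).
Proof.
  intros Ha Hb Hc.
  auto_derive; [repeat split; eexists; eassumption|].
  replace (Derive (fun s => a s) t) with a' by (symmetry; now apply is_derive_unique).
  replace (Derive (fun s => b s) t) with b' by (symmetry; now apply is_derive_unique).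
  replace (Derive (fun s => c s) t) with c' by (symmetry; now apply is_derive_unique).
  simpl. ring.
Qed.

Lemma is_derive_lorentz f t l q :
  is_derive3 f t l -> is_derive (fun s => lorentz (f s) q) t (lorentz l q).
Proof.
  intros (H0 & H1 & H2).
  assert (E : forall s, x0 (f s) * (- x0 q) + (x1 (f s) * x1 q + x2 (f s) * x2 q)
    = lorentz (f s) q) by (intros s; unfold lorentz; ring).
  apply (is_derive_ext _ _ _ _ E).
  replace (lorentz l q) with (x0 l * (- x0 q) + (x1 l * x1 q + x2 l * x2 q))
    by (unfold lorentz; ring).
  now apply is_derive_lin3.
Qed.

Lemma is_derive4_comb p e1 e2 (a b c d : R -> R) (t a' b' c' d' : R) :
  is_derive a t a' -> is_derive b t b' -> is_derive c t c' -> is_derive d t d' ->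
  is_derive4 (fun s => (comb p e1 e2 (a s) (b s) (c s), d s)) t
    (comb p e1 e2 a' b' c', d').
Proof.
  intros Ha Hb Hc Hd.
  assert (K := fun x y z => is_derive_lin3 a b c t a' b' c' x y z Ha Hb Hc).
  exact (conj (conj (K _ _ _) (conj (K _ _ _) (K _ _ _))) Hd).
Qed.

Lemma Cn4_2_is_derive F u v : Cn4 2 F u v ->
  is_derive4 (fun s => F s v) u (du4 F u v) /\
  is_derive4 (fun s => du4 F s v) u (du4 (du4 F) u v).
Proof.
  intros ((H0 & H1 & H2) & H3).
  split; refine (conj (conj _ (conj _ _)) _); apply Derive_correct;
    [apply H0|apply H1|apply H2|apply H3|apply H0|apply H1|apply H2|apply H3].
Qed.

Lemma independent_nonzero {V : NormedModule R_AbsRing} (v w : V) :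
  independent v w -> v <> zero /\ w <> zero.
Proof.
  intros Hi. split; intros ->.
  - destruct (Hi 1 0) as [H _]; [|lra].
    etransitivity; [|apply (plus_zero_l (zero : V))].
    f_equal; [apply (scal_zero_r (V := V))|apply (scal_zero_l (V := V))].
  - destruct (Hi 0 1) as [_ H]; [|lra].
    etransitivity; [|apply (plus_zero_l (zero : V))].
    f_equal; [apply (scal_zero_l (V := V))|apply (scal_zero_r (V := V))].
Qed.

(** The coordinates of both charts below are products of functions of one variable. *)
Lemma ex_diff_2_tensor (f f1 f2 g g1 g2 : R -> R) u v :
  (forall x, is_derive f x (f1 x)) -> (forall x, is_derive f1 x (f2 x)) ->
  (forall x, continuity_pt f2 x) ->
  (forall x, is_derive g x (g1 x)) -> (forall x, is_derive g1 x (g2 x)) ->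
  (forall x, continuity_pt g2 x) ->
  ex_diff_n (fun s t => f s * g t) 2 u v.
Proof.
  intros Hf Hf1 Cf Hg Hg1 Cg.
  assert (Du : forall a a1 b : R -> R, (forall x, is_derive a x (a1 x)) ->
    (fun s t => Derive (fun z => a z * b t) s) = (fun s t => a1 s * b t)).
  { intros a a1 b Ha. extensionality s. extensionality t.
    rewrite Derive_scal_l. f_equal. now apply is_derive_unique. }
  assert (Dv : forall a b b1 : R -> R, (forall x, is_derive b x (b1 x)) ->
    (fun s t => Derive (fun z => a s * b z) t) = (fun s t => a s * b1 t)).
  { intros a b b1 Hb. extensionality s. extensionality t.
    rewrite Derive_scal. f_equal. now apply is_derive_unique. }
  assert (C : forall a b : R -> R, (forall x, continuity_pt a x) ->
    (forall x, continuity_pt b x) -> continuity_2d_pt (fun s t => a s * b t) u v).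
  { intros a b Ha Hb. apply continuity_2d_pt_mult.
    - apply (continuity_1d_2d_pt_comp a (fun s _ => s)); [apply Ha|apply continuity_2d_pt_id1].
    - apply (continuity_1d_2d_pt_comp b (fun _ t => t)); [apply Hb|apply continuity_2d_pt_id2]. }
  assert (Cd : forall a a1 : R -> R, (forall x, is_derive a x (a1 x)) ->
    forall x, continuity_pt a x).
  { intros a a1 Ha x. apply derivable_continuous_pt. exists (a1 x).
    now apply is_derive_Reals. }
  assert (Eu : forall a a1 b : R -> R, (forall x, is_derive a x (a1 x)) ->
    ex_derive (fun z => a z * b v) u).
  { intros a a1 b Ha. auto_derive. now exists (a1 u). }
  assert (Ev : forall a b b1 : R -> R, (forall x, is_derive b x (b1 x)) ->
    ex_derive (fun z => a u * b z) v).
  { intros a b b1 Hb. auto_derive. now exists (b1 v). }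
  assert (Step : forall n (a a1 b b1 : R -> R),
    (forall x, is_derive a x (a1 x)) -> (forall x, is_derive b x (b1 x)) ->
    ex_diff_n (fun s t => a1 s * b t) n u v ->
    ex_diff_n (fun s t => a s * b1 t) n u v ->
    ex_diff_n (fun s t => a s * b t) (S n) u v).
  { intros n a a1 b b1 Ha Hb Hu Hv.
    split; [apply C; eauto|]. split; [eauto|]. split; [eauto|].
    rewrite (Du a a1 b Ha), (Dv a b b1 Hb). now split. }
  apply (Step 1%nat f f1 g g1); auto.
  - apply (Step 0%nat f1 f2 g g1); auto; (split; [apply C; eauto|trivial]).
  - apply (Step 0%nat f f1 g1 g2); auto; (split; [apply C; eauto|trivial]).
Qed.

Lemma even_derive_zero (f : R -> R) (a l d : R) :
  is_derive f a l -> 0 < d -> (forall t, 0 <= t < d -> f (a + t) = f (a - t)) -> l = 0.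
Proof.
  intros Hf Hd Ht.
  assert (H1 : is_derive (fun t => f (a + t) - f (a - t)) 0 (2 * l)).
  { auto_derive.
    - rewrite ?Ropp_0, ?Rplus_0_r. repeat split; eexists; eassumption.
    - rewrite ?Ropp_0, ?Rplus_0_r.
      replace (Derive (fun x => f x) a) with l by (symmetry; now apply is_derive_unique).
      ring. }
  assert (H2 : is_derive (fun t => f (a + t) - f (a - t)) 0 0).
  { apply (is_derive_ext_loc (fun _ => 0)).
    - exists (mkposreal d Hd). intros t Hb.
      change (Rabs (t - 0) < d) in Hb. apply Rabs_def2 in Hb.
      change (0 = f (a + t) - f (a - t)).
      destruct (Rle_or_lt 0 t) as [Hp|Hn].
      + rewrite (Ht t) by lra. ring.
      + specialize (Ht (- t) ltac:(lra)).
        replace (a + - t) with (a - t) in Ht by ring.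
        replace (a - - t) with (a + t) in Ht by ring. lra.
    - apply (is_derive_const (K := R_AbsRing) (V := R_NormedModule)). }
  apply is_derive_unique in H1. apply is_derive_unique in H2.
  rewrite H1 in H2. lra.
Qed.

Lemma continuity_2d_pt_section (f : R -> R -> R) u v :
  continuity_2d_pt f u v -> continuity_pt (fun s => f s v) u.
Proof.
  intros H. apply continuity_pt_locally. intros eps. destruct (H eps) as [d Hd].
  exists d. intros s Hs. apply Hd; [exact Hs|].
  rewrite Rminus_diag, Rabs_R0. apply cond_pos.
Qed.

Definition C2_fun (f : R -> R) : Prop := exists f1 f2 : R -> R,
  (forall x, is_derive f x (f1 x)) /\ (forall x, is_derive f1 x (f2 x)) /\
  (forall x, continuity_pt f2 x).

Lemma C2_fun_sin : C2_fun sin.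
Proof.
  exists cos, (fun x => - sin x). split; [|split]; intros x.
  - apply is_derive_sin.
  - apply is_derive_cos.
  - apply continuity_pt_opp, continuity_sin.
Qed.
Lemma C2_fun_cos : C2_fun cos.
Proof.
  exists (fun x => - sin x), (fun x => - cos x). split; [|split]; intros x.
  - apply is_derive_cos.
  - auto_derive; [trivial|ring].
  - apply continuity_pt_opp, continuity_cos.
Qed.
Lemma C2_fun_one : C2_fun (fun _ => 1).
Proof.
  exists (fun _ => 0), (fun _ => 0). split; [|split]; intros x.
  - apply (is_derive_const (K := R_AbsRing) (V := R_NormedModule)).
  - apply (is_derive_const (K := R_AbsRing) (V := R_NormedModule)).
  - apply continuity_pt_const. now intros ? ?.
Qed.

Lemma ex_diff_2_product (f g : R -> R) (F : R -> R -> R) u v :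
  C2_fun f -> C2_fun g -> (forall s t, F s t = f s * g t) -> ex_diff_n F 2 u v.
Proof.
  intros (f1 & f2 & Hf & Hf1 & Hf2) (g1 & g2 & Hg & Hg1 & Hg2) HF.
  replace F with (fun s t => f s * g t)
    by (extensionality s; extensionality t; now rewrite HF).
  eapply ex_diff_2_tensor; eassumption.
Qed.

Lemma scal_plus_vec3 (a b : R) (v w : vec3) :
  plus (scal a v) (scal b w) = zero ->
  a * x0 v + b * x0 w = 0 /\ a * x1 v + b * x1 w = 0 /\ a * x2 v + b * x2 w = 0.
Proof.
  intros E. split; [|split].
  - exact (f_equal x0 E).
  - exact (f_equal x1 E).
  - exact (f_equal x2 E).
Qed.

Lemma cos_sin_cancel (a v : R) : a * cos v = 0 -> a * sin v = 0 -> a = 0.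
Proof.
  intros Hc Hs. assert (T := sin2_cos2 v). unfold Rsqr in T.
  replace a with (a * sin v * sin v + a * cos v * cos v)
    by (rewrite <- (Rmult_1_r a) at 3; rewrite <- T; ring).
  rewrite Hc, Hs. ring.
Qed.

Lemma open_first_coordinate (a b u v : R) :
  a < u < b -> locally_2d (fun s _ => a < s < b) u v.
Proof.
  intros Hu. assert (Hd : 0 < Rmin (u - a) (b - u)) by (apply Rmin_glb_lt; lra).
  exists (mkposreal _ Hd). intros s t Hs _. simpl in Hs.
  apply Rabs_def2 in Hs.
  assert (T1 := Rmin_l (u - a) (b - u)). assert (T2 := Rmin_r (u - a) (b - u)). lra.
Qed.

Lemma open_second_coordinate (a b u v : R) :
  a < v < b -> locally_2d (fun _ t => a < t < b) u v.
Proof.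
  intros Hv. destruct (open_first_coordinate a b v u Hv) as [d Hd].
  exists d. intros s t Hs Ht. now apply (Hd t s).
Qed.

Lemma polar_chart : S2_chart (fun s _ => 0 < s < PI) polar.
Proof.
  split.
  - intros u v. apply open_first_coordinate.
  - intros u v _. unfold in_S2, polar, x0, x1, x2; simpl.
    assert (T := sin2_cos2 v). assert (T' := sin2_cos2 u). unfold Rsqr in *.
    transitivity (sin u * sin u * (sin v * sin v + cos v * cos v) + cos u * cos u);
      [ring|rewrite T; lra].
  - intros u v _. split; [|split].
    + apply (ex_diff_2_product sin cos); [apply C2_fun_sin|apply C2_fun_cos|reflexivity].
    + apply (ex_diff_2_product sin sin); [apply C2_fun_sin|apply C2_fun_sin|reflexivity].
    + apply (ex_diff_2_product cos (fun _ => 1)); [apply C2_fun_cos|apply C2_fun_one|].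
      intros. unfold polar, x2. simpl. ring.
  - intros u v Hu a b E.
    assert (Du : du3 polar u v = (cos u * cos v, cos u * sin v, - sin u)).
    { unfold du3, Derive3, polar, x0, x1, x2; simpl.
      repeat apply (f_equal2 (@pair _ _)); apply is_derive_unique; auto_derive; trivial; ring. }
    assert (Dv : dv3 polar u v = (- sin u * sin v, sin u * cos v, 0)).
    { unfold dv3, Derive3, polar, x0, x1, x2; simpl.
      repeat apply (f_equal2 (@pair _ _)); apply is_derive_unique; auto_derive; trivial; ring. }
    rewrite Du, Dv in E. apply scal_plus_vec3 in E. simpl in E.
    unfold x0, x1, x2 in E; simpl in E. destruct E as (E0 & E1 & E2).
    assert (Hs : 0 < sin u) by (apply sin_gt_0; lra).
    assert (Ha : a = 0).
    { apply (Rmult_eq_reg_r (sin u)); lra. }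
    split; [assumption|]. subst a.
    apply (cos_sin_cancel b v); apply (Rmult_eq_reg_r (sin u)); lra.
Qed.

(** A chart around the great circle formed by the meridians of longitude [0] and
    [PI]. Unlike [polar] it is regular at both poles, and its parameter [a] runs
    through all real numbers. *)
Definition meridian_chart (a b : R) : vec3 := (sin a * cos b, sin b, cos a * cos b).

Lemma meridian_chart_chart :
  S2_chart (fun _ b => - (PI / 2) < b < PI / 2) meridian_chart.
Proof.
  split.
  - intros u v. apply open_second_coordinate.
  - intros u v _. unfold in_S2, meridian_chart, x0, x1, x2; simpl.
    assert (T := sin2_cos2 v). assert (T' := sin2_cos2 u). unfold Rsqr in *.
    transitivity ((sin u * sin u + cos u * cos u) * (cos v * cos v) + sin v * sin v);
      [ring|rewrite T'; lra].
  - intros u v _. split; [|split].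
    + apply (ex_diff_2_product sin cos); [apply C2_fun_sin|apply C2_fun_cos|reflexivity].
    + apply (ex_diff_2_product (fun _ => 1) sin); [apply C2_fun_one|apply C2_fun_sin|].
      intros. unfold meridian_chart, x1. simpl. ring.
    + apply (ex_diff_2_product cos cos); [apply C2_fun_cos|apply C2_fun_cos|reflexivity].
  - intros u v Hv a b E.
    assert (Du : du3 meridian_chart u v = (cos u * cos v, 0, - sin u * cos v)).
    { unfold du3, Derive3, meridian_chart, x0, x1, x2; simpl.
      repeat apply (f_equal2 (@pair _ _)); apply is_derive_unique; auto_derive; trivial; ring. }
    assert (Dv : dv3 meridian_chart u v = (- sin u * sin v, cos v, - cos u * sin v)).
    { unfold dv3, Derive3, meridian_chart, x0, x1, x2; simpl.
      repeat apply (f_equal2 (@pair _ _)); apply is_derive_unique; auto_derive; trivial; ring. }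
    rewrite Du, Dv in E. apply scal_plus_vec3 in E.
    unfold x0, x1, x2 in E; simpl in E. destruct E as (E0 & E1 & E2).
    assert (Hc : 0 < cos v) by (apply cos_gt_0; lra).
    assert (Hb : b = 0).
    { apply (Rmult_eq_reg_r (cos v)); lra. }
    split; [|assumption]. subst b.
    apply (cos_sin_cancel a u); apply (Rmult_eq_reg_r (cos v)); lra.
Qed.

Lemma meridian_chart_polar s : meridian_chart s 0 = polar s 0.
Proof.
  unfold meridian_chart, polar. rewrite cos_0, sin_0.
  repeat apply (f_equal2 (@pair _ _)); ring.
Qed.

Lemma polar_neg s : polar (- s) PI = polar s 0.
Proof.
  unfold polar. rewrite cos_neg, sin_neg, cos_PI, sin_PI, cos_0, sin_0.
  repeat apply (f_equal2 (@pair _ _)); ring.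
Qed.
Lemma polar_period s theta : polar (s + 2 * PI) theta = polar s theta.
Proof.
  unfold polar. now rewrite (sin_plus s), (cos_plus s), cos_2PI, sin_2PI,
    !Rmult_0_r, !Rmult_1_r, Rplus_0_r, Rminus_0_r.
Qed.

(** * From the rotational sphere to its meridian *)

Lemma rotation_of_geodesic p e1 e2 theta q t : frame p e1 e2 ->
  fst q = geodesic p e1 t ->
  rotation p e1 e2 theta q =
    (comb p e1 e2 (cosh t) (sinh t * cos theta) (sinh t * sin theta), snd q).
Proof.
  intros Hf Hq. unfold rotation. rewrite Hq.
  replace (geodesic p e1 t) with (comb p e1 e2 (cosh t) (sinh t) 0).
  - rewrite lorentz_comb_p, lorentz_comb_e1, lorentz_comb_e2 by assumption.
    rewrite Ropp_involutive, !Rmult_0_l, Rminus_0_r, Rplus_0_r. reflexivity.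
  - unfold comb, geodesic. f_equal.
    apply vec3_ext; [change (sinh t * x0 e1 + 0 * x0 e2 = sinh t * x0 e1)
      |change (sinh t * x1 e1 + 0 * x1 e2 = sinh t * x1 e1)
      |change (sinh t * x2 e1 + 0 * x2 e2 = sinh t * x2 e1)]; ring.
Qed.

(** In orthogonal parameters with vanishing mixed coefficient, the coefficient
    of [t] in [det (II - t I)] yields the sum of the principal curvatures. *)
Lemma mean_curvature_diagonal (F : R -> R -> vec4) N u v h :
  is_mean_curvature F N u v h ->
  0 < metric (du4 F u v) (du4 F u v) ->
  0 < metric (dv4 F u v) (dv4 F u v) ->
  metric (du4 F u v) (dv4 F u v) = 0 ->
  metric (du4 (dv4 F) u v) N = 0 ->
  metric (du4 (du4 F) u v) N / metric (du4 F u v) (du4 F u v)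
  + metric (dv4 (dv4 F) u v) N / metric (dv4 F u v) (dv4 F u v) = 2 * h.
Proof.
  intros (k1 & k2 & Hk & ->) HE HG HF HM.
  assert (T1 := Hk 1). assert (T2 := Hk (-1)).
  unfold det_pencil, det_first_form in T1, T2. cbv zeta in T1, T2.
  rewrite HF, HM in T1, T2.
  set (E := metric (du4 F u v) (du4 F u v)) in *.
  set (G := metric (dv4 F u v) (dv4 F u v)) in *.
  set (L := metric (du4 (du4 F) u v) N) in *.
  set (Q := metric (dv4 (dv4 F) u v) N) in *.
  clearbody E G L Q. clear HF HM Hk.
  apply (Rmult_eq_reg_r (E * G)); [|nra].
  transitivity (L * G + Q * E); [field; lra|].
  transitivity (E * G * (k1 + k2)); [|field]. lra.
Qed.

(** Here [r] is the hyperbolic sine of the signed distance to the axis; the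
    coefficient [ch (r s)] of [p] is then forced by the equation of the
    hyperboloid. *)
Definition swept (X : vec3 -> vec4) (psi : vec3 -> vec3) (p e1 e2 : vec3) (r z : R -> R) : Prop :=
  forall s theta, 0 <= s <= PI ->
    X (psi (polar s theta)) =
      (comb p e1 e2 (ch (r s)) (r s * cos theta) (r s * sin theta), z s).

Lemma rotational_swept X psi p e1 e2 alpha : frame p e1 e2 ->
  (forall s, 0 <= s <= PI -> in_vertical_plane p e1 (alpha s)) ->
  (forall s theta, 0 <= s <= PI ->
     X (psi (polar s theta)) = rotation p e1 e2 theta (alpha s)) ->
  swept X psi p e1 e2 (fun s => lorentz (fst (X (psi (polar s 0)))) e1)
    (fun s => snd (X (psi (polar s 0)))).
Proof.
  intros Hf Hv Hr s theta Hs. destruct (Hv s Hs) as [t Ht].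
  rewrite !(Hr s) by assumption.
  rewrite !(rotation_of_geodesic p e1 e2 _ _ t) by assumption.
  simpl. rewrite lorentz_comb_e1 by assumption.
  now rewrite cos_0, Rmult_1_r, ch_sinh.
Qed.

(** The meridian extends, past the poles, to a regular curve of class C^2 on the
    whole line, because it is a coordinate line of a chart that is regular
    there. *)
Lemma meridian_regular X psi : immersed_sphere X -> S2_diffeo psi ->
  forall a, let g := fun s => X (psi (polar s 0)) in
    is_derive4 g a (Derive4 g a) /\
    is_derive4 (Derive4 g) a (Derive4 (Derive4 g) a) /\
    Derive4 g a <> zero.
Proof.
  intros [_ HC Hi] Hpsi a g.
  assert (Hch := diffeo_chart _ Hpsi _ _ meridian_chart_chart).
  assert (H0 : - (PI / 2) < 0 < PI / 2) by (assert (T := PI_RGT_0); lra).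
  assert (Eg : (fun s => X (psi (meridian_chart s 0))) = g).
  { extensionality s. now rewrite meridian_chart_polar. }
  destruct (Cn4_2_is_derive _ _ _ (HC _ _ Hch a 0 H0)) as [D1 D2].
  destruct (independent_nonzero _ _ (Hi _ _ Hch a 0 H0)) as [D3 _].
  unfold du4 in D1, D2, D3. rewrite Eg in D1, D2, D3. auto.
Qed.

Lemma meridian_normal X eta psi : unit_normal X eta -> S2_diffeo psi ->
  forall a, let g := fun s => X (psi (polar s 0)) in
    let N := fun s => eta (psi (polar s 0)) in
    (forall q, continuity_pt (fun s => lorentz (fst (N s)) q) a) /\
    continuity_pt (fun s => snd (N s)) a /\
    metric (Derive4 g a) (N a) = 0.
Proof.
  intros [_ _ HC Ho] Hpsi a g N.
  assert (Hch := diffeo_chart _ Hpsi _ _ meridian_chart_chart).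
  assert (H0 : - (PI / 2) < 0 < PI / 2) by (assert (T := PI_RGT_0); lra).
  assert (Eg : (fun s => X (psi (meridian_chart s 0))) = g).
  { extensionality s. now rewrite meridian_chart_polar. }
  assert (EN : (fun s => eta (psi (meridian_chart s 0))) = N).
  { extensionality s. now rewrite meridian_chart_polar. }
  destruct (HC _ _ Hch a 0 H0) as (([C0 _] & [C1 _] & [C2 _]) & [C3 _]).
  apply continuity_2d_pt_section in C0, C1, C2, C3.
  assert (K0 : continuity_pt (fun s => x0 (fst (N s))) a) by (rewrite <- EN; exact C0).
  assert (K1 : continuity_pt (fun s => x1 (fst (N s))) a) by (rewrite <- EN; exact C1).
  assert (K2 : continuity_pt (fun s => x2 (fst (N s))) a) by (rewrite <- EN; exact C2).
  assert (K3 : continuity_pt (fun s => snd (N s)) a) by (rewrite <- EN; exact C3).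
  split; [|split].
  - intros q. unfold lorentz.
    assert (Kc : forall c, continuity_pt (fun _ => c) a).
    { intros c. apply continuity_pt_const. now intros ? ?. }
    apply (continuity_pt_plus (fun s => - (x0 (fst (N s)) * x0 q) + x1 (fst (N s)) * x1 q)
      (fun s => x2 (fst (N s)) * x2 q)).
    + apply (continuity_pt_plus (fun s => - (x0 (fst (N s)) * x0 q))
        (fun s => x1 (fst (N s)) * x1 q)).
      * apply (continuity_pt_opp (fun s => x0 (fst (N s)) * x0 q)).
        now apply (continuity_pt_mult (fun s => x0 (fst (N s))) (fun _ => x0 q)).
      * now apply (continuity_pt_mult (fun s => x1 (fst (N s))) (fun _ => x1 q)).
    + now apply (continuity_pt_mult (fun s => x2 (fst (N s))) (fun _ => x2 q)).
  - exact K3.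
  - destruct (Ho _ _ Hch a 0 H0) as [O _].
    unfold du4 in O. rewrite Eg, meridian_chart_polar in O. exact O.
Qed.

(** Past a pole the great circle continues along the opposite meridian, so that
    passing from [a - t] to [a + t] is a half-turn around the axis: it changes
    only the sign of the radial coordinate. *)
Lemma swept_reflection X psi p e1 e2 r z : swept X psi p e1 e2 r z ->
  forall a t, a = 0 \/ a = PI -> 0 <= t < PI ->
  X (psi (polar (a + t) 0)) = (comb p e1 e2 (ch (r (a - t))) (- r (a - t)) 0, z (a - t)) /\
  X (psi (polar (a - t) 0)) = (comb p e1 e2 (ch (r (a - t))) (r (a - t)) 0, z (a - t))
  \/
  X (psi (polar (a - t) 0)) = (comb p e1 e2 (ch (r (a + t))) (- r (a + t)) 0, z (a + t)) /\
  X (psi (polar (a + t) 0)) = (comb p e1 e2 (ch (r (a + t))) (r (a + t)) 0, z (a + t)).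
Proof.
  intros HS a t Ha Ht.
  assert (Opp : forall s u, 0 <= s <= PI -> polar u 0 = polar s PI ->
    X (psi (polar u 0)) = (comb p e1 e2 (ch (r s)) (- r s) 0, z s)).
  { intros s u Hs ->. rewrite (HS s PI Hs), cos_PI, sin_PI.
    replace (r s * -1) with (- r s) by ring. now rewrite Rmult_0_r. }
  assert (Same : forall s, 0 <= s <= PI ->
    X (psi (polar s 0)) = (comb p e1 e2 (ch (r s)) (r s) 0, z s)).
  { intros s Hs. rewrite (HS s 0 Hs), cos_0, sin_0. now rewrite Rmult_1_r, Rmult_0_r. }
  destruct Ha as [-> | ->].
  - right. split; [|apply Same; lra]. apply Opp; [lra|].
    replace (0 - t) with (- (0 + t)) by ring. rewrite <- polar_neg. f_equal. ring.
  - left. split; [|apply Same; lra]. apply Opp; [lra|].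
    rewrite <- (polar_period (PI - t)), <- polar_neg, <- polar_period.
    rewrite <- (polar_period _ PI) . f_equal. ring.
Qed.

(** By [swept_reflection] the coordinates of the meridian along [p], [e2] and the
    vertical are even about a pole, so its velocity there is a nonzero multiple
    of [e1]; the normal is orthogonal to it. *)
Lemma normal_at_pole X eta psi p e1 e2 r z a :
  immersed_sphere X -> unit_normal X eta -> S2_diffeo psi -> frame p e1 e2 ->
  swept X psi p e1 e2 r z -> a = 0 \/ a = PI ->
  r a = 0 /\ lorentz (fst (eta (psi (polar a 0)))) e1 = 0.
Proof.
  intros HX HN Hpsi Hf HS Ha.
  assert (HPI := PI_RGT_0).
  assert (Ref := swept_reflection _ _ _ _ _ _ _ HS a).
  destruct (meridian_regular X psi HX Hpsi a) as (D1 & _ & Dn).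
  destruct (meridian_normal X eta psi HN Hpsi a) as (_ & _ & O).
  set (g := fun s => X (psi (polar s 0))) in *.
  set (N := eta (psi (polar a 0))) in *.
  destruct D1 as [D1 D1z].
  split.
  - assert (Ref0 := Ref 0 Ha ltac:(lra)). rewrite Rplus_0_r, Rminus_0_r in Ref0.
    destruct Ref0 as [[E1 E2]|[E1 E2]]; rewrite E1 in E2;
      apply (f_equal fst) in E2; simpl in E2;
      apply (f_equal (fun v => lorentz v e1)) in E2;
      rewrite !lorentz_comb_e1 in E2 by assumption; lra.
  - assert (Ep : lorentz (fst (Derive4 g a)) p = 0).
    { apply (even_derive_zero (fun s => lorentz (fst (g s)) p) a _ PI);
        [now apply is_derive_lorentz|assumption|].
      intros t Ht. unfold g.
      destruct (Ref t Ha Ht) as [[-> ->]|[-> ->]]; simpl;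
        now rewrite !lorentz_comb_p by assumption. }
    assert (E2 : lorentz (fst (Derive4 g a)) e2 = 0).
    { apply (even_derive_zero (fun s => lorentz (fst (g s)) e2) a _ PI);
        [now apply is_derive_lorentz|assumption|].
      intros t Ht. unfold g.
      destruct (Ref t Ha Ht) as [[-> ->]|[-> ->]]; simpl;
        now rewrite !lorentz_comb_e2 by assumption. }
    assert (Ez : snd (Derive4 g a) = 0).
    { apply (even_derive_zero (fun s => snd (g s)) a _ PI); [assumption|assumption|].
      intros t Ht. unfold g.
      destruct (Ref t Ha Ht) as [[-> ->]|[-> ->]]; reflexivity. }
    assert (Ev := frame_expand p e1 e2 (fst (Derive4 g a)) Hf).
    rewrite Ep, E2 in Ev. set (l := lorentz (fst (Derive4 g a)) e1) in Ev.
    assert (Hl : l <> 0).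
    { intros Hl. apply Dn. rewrite (surjective_pairing (Derive4 g a)), Ez, Ev, Hl.
      apply (f_equal2 pair); [|reflexivity].
      apply vec3_ext; [rewrite comb_x0|rewrite comb_x1|rewrite comb_x2];
        rewrite Ropp_0, !Rmult_0_l, !Rplus_0_l; reflexivity. }
    unfold metric in O. rewrite Ev, Ez, lorentz_comb_l in O.
    rewrite (lorentz_sym e1) in O.
    apply (Rmult_eq_reg_l l); [|assumption]. lra.
Qed.

(** The fundamental forms at longitude [0], computed in the polar chart. The
    coefficient [A] of the normal along [p] is determined by tangency to the
    hyperboloid, and the one along [e2] vanishes because the parallels have
    direction [e2]. *)
Lemma mean_curvature_profile H X eta psi p e1 e2 (r r1 r2 z z1 z2 : R -> R) (s : R) :
  immersed_sphere X -> unit_normal X eta -> S2_diffeo psi -> frame p e1 e2 ->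
  (forall U phi, S2_chart U phi -> forall u v, U u v ->
        is_mean_curvature (fun s t => X (phi s t)) (eta (phi u v)) u v
          (H (angle eta (phi u v)))) ->
  swept X psi p e1 e2 r z ->
  (forall t, is_derive r t (r1 t)) -> (forall t, is_derive r1 t (r2 t)) ->
  (forall t, is_derive z t (z1 t)) -> (forall t, is_derive z1 t (z2 t)) ->
  0 < s < PI ->
  let N := eta (psi (polar s 0)) in
  let beta := lorentz (fst N) e1 in
  let n := snd N in
  let c := ch (r s) in
  let P := r1 s / c in
  r s <> 0 /\ 0 < P ^ 2 + z1 s ^ 2 /\ (beta / c) ^ 2 + n ^ 2 = 1 /\
  P * (beta / c) + z1 s * n = 0 /\
  ((r2 s - r s * P ^ 2) / c * (beta / c) + z2 s * n) / (P ^ 2 + z1 s ^ 2) - beta / r s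
    = 2 * H n.
Proof.
  intros HX HN Hpsi Hf HH HS Dr Dr1 Dz Dz1 Hs N beta n c P.
  assert (Hch := diffeo_chart _ Hpsi _ _ polar_chart).
  set (F := fun s t => X (psi (polar s t))) in *.
  assert (Hloc : forall t, 0 < t < PI -> locally t (fun x => 0 < x < PI)).
  { intros t Ht. destruct (open_first_coordinate 0 PI t 0 Ht) as [d Hd].
    exists d. intros x Hx. apply (Hd x 0); [exact Hx|].
    rewrite Rminus_diag, Rabs_R0. apply cond_pos. }
  (* The first two derivatives of the coefficient ch r along p; the second comes
     from differentiating ch r * c1 = r * r1. *)
  set (c1 := fun t => r t * r1 t / ch (r t)).
  set (c2 := fun t => (r1 t ^ 2 + r t * r2 t - c1 t ^ 2) / ch (r t)).
  assert (Dc : forall t, is_derive (fun x => ch (r x)) t (c1 t)).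
  { intros t. now apply is_derive_ch. }
  assert (Dc1 : forall t, is_derive c1 t (c2 t)).
  { intros t. assert (Pc := ch_pos (r t)).
    assert (Dq : forall q : R -> R, is_derive q t (c1 t) -> q t = ch (r t) ->
      is_derive (fun x => r x * r1 x / q x) t (c2 t)).
    { intros q Dq Eq. auto_derive.
      - repeat split; try (eexists; eauto; fail). lra.
      - replace (Derive (fun x => r x) t) with (r1 t) by (symmetry; now apply is_derive_unique).
        replace (Derive (fun x => r1 x) t) with (r2 t) by (symmetry; now apply is_derive_unique).
        replace (Derive (fun x => q x) t) with (c1 t) by (symmetry; now apply is_derive_unique).
        rewrite Eq. unfold c2, c1. field. lra. }
    exact (Dq (fun x => ch (r x)) (Dc t) eq_refl). }
  assert (Ds : forall (f : R -> R) (k t f' : R), is_derive f t f' ->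
    is_derive (fun x => f x * k) t (f' * k)).
  { intros f k t f' Hf'. auto_derive; [now exists f'|].
    rewrite Rmult_1_l. f_equal. now apply is_derive_unique. }
  assert (D0 : forall t : R, is_derive (fun _ => 0) t 0).
  { intros t. apply (is_derive_const (K := R_AbsRing) (V := R_NormedModule)). }
  assert (Fu : forall t th, 0 < t < PI ->
    du4 F t th = (comb p e1 e2 (c1 t) (r1 t * cos th) (r1 t * sin th), z1 t)).
  { intros t th Ht. apply Derive4_unique.
    apply (is_derive4_ext_loc
      (fun x => (comb p e1 e2 (ch (r x)) (r x * cos th) (r x * sin th), z x))).
    - eapply filter_imp; [|apply (Hloc t Ht)]. intros x Hx. symmetry.
      apply HS. simpl in Hx; lra.
    - apply is_derive4_comb; auto. }
  assert (Fv : forall t th, 0 < t < PI ->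
    dv4 F t th = (comb p e1 e2 0 (r t * - sin th) (r t * cos th), 0)).
  { intros t th Ht. apply Derive4_unique.
    apply (is_derive4_ext_loc
      (fun x => (comb p e1 e2 (ch (r t)) (r t * cos x) (r t * sin x), z t))).
    - apply filter_forall. intros x. symmetry. apply HS. lra.
    - apply is_derive4_comb;
      [apply (is_derive_const (K := R_AbsRing) (V := R_NormedModule))
      |auto_derive; [trivial|ring]|auto_derive; [trivial|ring]
      |apply (is_derive_const (K := R_AbsRing) (V := R_NormedModule))]. }
  assert (Fuu : du4 (du4 F) s 0 = (comb p e1 e2 (c2 s) (r2 s * cos 0) (r2 s * sin 0), z2 s)).
  { apply Derive4_unique.
    apply (is_derive4_ext_loc
      (fun x => (comb p e1 e2 (c1 x) (r1 x * cos 0) (r1 x * sin 0), z1 x))).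
    - eapply filter_imp; [|apply (Hloc s Hs)]. intros x Hx. symmetry. now apply Fu.
    - apply is_derive4_comb; auto. }
  assert (Fuv : du4 (dv4 F) s 0 = (comb p e1 e2 0 (r1 s * - sin 0) (r1 s * cos 0), 0)).
  { apply Derive4_unique.
    apply (is_derive4_ext_loc
      (fun x => (comb p e1 e2 0 (r x * - sin 0) (r x * cos 0), 0))).
    - eapply filter_imp; [|apply (Hloc s Hs)]. intros x Hx. symmetry. now apply Fv.
    - apply is_derive4_comb; auto. }
  assert (Fvv : dv4 (dv4 F) s 0 = (comb p e1 e2 0 (r s * - cos 0) (r s * - sin 0), 0)).
  { apply Derive4_unique.
    apply (is_derive4_ext_loc
      (fun x => (comb p e1 e2 0 (r s * - sin x) (r s * cos x), 0))).
    - apply filter_forall. intros x. symmetry. now apply Fv.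
    - apply is_derive4_comb; auto; auto_derive; trivial; ring. }
  assert (Xs := HS s 0 ltac:(lra)).
  specialize (Fu s 0 Hs). specialize (Fv s 0 Hs).
  rewrite cos_0, sin_0, Rmult_0_r, Rmult_1_r in Fu, Fuu, Xs.
  rewrite cos_0, sin_0, Ropp_0, Rmult_0_r, Rmult_1_r in Fv, Fuv.
  rewrite cos_0, sin_0, Ropp_0, Rmult_0_r in Fvv.
  assert (Tan := normal_tangent _ _ HN (psi (polar s 0))
    (diffeo_S2 _ Hpsi _ (chart_S2 _ _ polar_chart s 0 Hs))).
  assert (Uni := normal_unit _ _ HN (psi (polar s 0))
    (diffeo_S2 _ Hpsi _ (chart_S2 _ _ polar_chart s 0 Hs))).
  destruct (normal_orthogonal _ _ HN _ _ Hch s 0 Hs) as [Ou Ov].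
  destruct (independent_nonzero _ _ (sphere_immersion _ HX _ _ Hch s 0 Hs)) as [Nu Nv].
  assert (HM := HH _ _ Hch s 0 Hs).
  change (lorentz (fst (F s 0)) (fst N) = 0) in Tan.
  change (metric N N = 1) in Uni.
  change (metric (du4 F s 0) N = 0) in Ou. change (metric (dv4 F s 0) N = 0) in Ov.
  change (du4 F s 0 <> zero) in Nu. change (dv4 F s 0 <> zero) in Nv.
  change (is_mean_curvature F N s 0 (H (angle eta (psi (polar s 0))))) in HM.
  assert (Hn : angle eta (psi (polar s 0)) = n).
  { unfold angle, metric, dz, lorentz, n, N, x0, x1, x2. simpl. ring. }
  rewrite Hn in HM. clear Hn.
  assert (EN : N = (comb p e1 e2 (- lorentz (fst N) p) beta (lorentz (fst N) e2), n))
    by (rewrite (surjective_pairing N) at 1; f_equal; now apply frame_expand).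
  set (A := - lorentz (fst N) p) in EN. set (D := lorentz (fst N) e2) in EN.
  change (F s 0 = (comb p e1 e2 (ch (r s)) (r s) 0, z s)) in Xs.
  rewrite Xs, EN in Tan. simpl in Tan. rewrite lorentz_comb in Tan by assumption.
  rewrite EN, metric_comb in Uni by assumption.
  rewrite EN, Fu, metric_comb in Ou by assumption.
  rewrite EN, Fv, metric_comb in Ov by assumption.
  assert (Pc := ch_pos (r s)). assert (Qc := ch_sq (r s)). fold c in Pc, Qc, Tan.
  assert (Nr : r s <> 0).
  { intros E. apply Nv. rewrite Fv, E, comb_zero. reflexivity. }
  assert (ED : D = 0).
  { apply (Rmult_eq_reg_l (r s)); [lra|assumption]. }
  assert (EA : A = r s * beta / c).
  { apply (Rmult_eq_reg_r c); [|lra]. transitivity (r s * beta); [lra|field; lra]. }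
  assert (Ec1 : c1 s = r s * P) by (unfold c1, P, c; field; unfold c in Pc; lra).
  assert (Er1 : r1 s = c * P) by (unfold P; field; lra).
  assert (EE : - (c1 s * c1 s) + r1 s * r1 s = P ^ 2).
  { rewrite Ec1, Er1. transitivity (P ^ 2 * (c ^ 2 - r s ^ 2)); [ring|rewrite Qc; ring]. }
  assert (Hreg : 0 < P ^ 2 + z1 s ^ 2).
  { destruct (Req_dec (P ^ 2 + z1 s ^ 2) 0) as [E|E].
    - exfalso. apply Nu.
      assert (EP : P = 0) by nra. assert (Ez : z1 s = 0) by nra.
      rewrite Fu, Ec1, Er1, EP, Ez, !Rmult_0_r, comb_zero. reflexivity.
    - assert (T := pow2_ge_0 P). assert (T' := pow2_ge_0 (z1 s)). lra. }
  split; [assumption|]. split; [assumption|]. split; [|split].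
  - rewrite <- Uni, ED, EA.
    transitivity (beta ^ 2 * (c ^ 2 - r s ^ 2) / c ^ 2 + n ^ 2); [|field; lra].
    rewrite Qc at 1. field. lra.
  - rewrite <- Ou, ED, EA, Ec1, Er1.
    transitivity (P * beta * (c ^ 2 - r s ^ 2) / c + z1 s * n); [|field; lra].
    rewrite Qc. field. lra.
  - apply mean_curvature_diagonal in HM;
      rewrite ?Fuu, ?Fvv, ?Fuv, ?Fu, ?Fv, ?EN, !metric_comb in * by assumption.
    + rewrite <- HM.
      assert (Ec2 : c2 s = (P ^ 2 + r s * r2 s) / c).
      { unfold c2. rewrite Ec1, Er1. fold c.
        transitivity ((P ^ 2 * (c ^ 2 - r s ^ 2) + r s * r2 s) / c); [field; lra|].
        rewrite Qc. field. lra. }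
      assert (EL : - (c2 s * A) + r2 s * beta + 0 * D + z2 s * n
        = (r2 s - r s * P ^ 2) / c * (beta / c) + z2 s * n).
      { rewrite Ec2, EA.
        transitivity (beta * (r2 s * (c ^ 2 - r s ^ 2) - r s * P ^ 2) / c ^ 2 + z2 s * n);
          [field; lra|]. rewrite Qc at 1. field. lra. }
      rewrite EL, EE. replace (P ^ 2 + 0 * 0 + z1 s * z1 s) with (P ^ 2 + z1 s ^ 2) by ring.
      set (L := (r2 s - r s * P ^ 2) / c * (beta / c) + z2 s * n).
      set (E := P ^ 2 + z1 s ^ 2) in *. field. split; lra.
    + rewrite EE. lra.
    + nra.
    + ring.
    + rewrite ED. ring.
Qed.

Lemma rotational_profile H X : H_sphere H X -> rotational_sphere X ->
  exists r r1 r2 z1 z2 beta n, profile H r r1 r2 z1 z2 beta n.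
Proof.
  intros (HX & eta & HN & HH) (p & e1 & e2 & psi & alpha & Hf & Hpsi & _ & Hv & Hr).
  assert (HS := rotational_swept X psi p e1 e2 alpha Hf Hv Hr).
  set (g := fun s => X (psi (polar s 0))) in *.
  set (N := fun s => eta (psi (polar s 0))).
  assert (Reg := meridian_regular X psi HX Hpsi). cbv zeta in Reg.
  assert (Nor := meridian_normal X eta psi HN Hpsi). cbv zeta in Nor.
  set (r := fun s => lorentz (fst (g s)) e1).
  set (r1 := fun s => lorentz (fst (Derive4 g s)) e1).
  set (r2 := fun s => lorentz (fst (Derive4 (Derive4 g) s)) e1).
  set (z1 := fun s => snd (Derive4 g s)).
  set (z2 := fun s => snd (Derive4 (Derive4 g) s)).
  assert (Dr : forall s, is_derive r s (r1 s))
    by (intros s; destruct (Reg s) as ([D _] & _); now apply is_derive_lorentz).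
  assert (Dr1 : forall s, is_derive r1 s (r2 s))
    by (intros s; destruct (Reg s) as (_ & [D _] & _); now apply is_derive_lorentz).
  assert (Dz : forall s, is_derive (fun s => snd (g s)) s (z1 s))
    by (intros s; destruct (Reg s) as ([_ D] & _); exact D).
  assert (Dz1 : forall s, is_derive z1 s (z2 s))
    by (intros s; destruct (Reg s) as (_ & [_ D] & _); exact D).
  assert (Int := fun s => mean_curvature_profile H X eta psi p e1 e2 r r1 r2 _ z1 z2 s
    HX HN Hpsi Hf HH HS Dr Dr1 Dz Dz1). cbv zeta in Int.
  assert (Pole := fun a => normal_at_pole X eta psi p e1 e2 r _ a HX HN Hpsi Hf HS).
  exists r, r1, r2, z1, z2, (fun s => lorentz (fst (N s)) e1), (fun s => snd (N s)).
  split; try assumption.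
  - intros s. apply (Nor s).
  - intros s. apply (Nor s).
  - apply (Pole 0). now left.
  - apply (Pole PI). now right.
  - apply (Pole 0). now left.
  - apply (Pole PI). now right.
  - intros s Hs. apply (Int s Hs).
  - intros s Hs. apply (Int s Hs).
  - intros s Hs. apply (Int s Hs).
  - intros s Hs. apply (Int s Hs).
  - intros s Hs. apply (Int s Hs).
Qed.

Theorem proposition3p6 :
  forall H : R -> R,
    C1_function H ->
    isolated_zeros H ->
    zeros_of_finite_multiplicity H ->
    (exists X : vec3 -> vec4, H_sphere H X /\ rotational_sphere X) ->
    (forall y : R, -1 <= y <= 1 -> 2 * Rabs (H y) > sqrt (1 - y ^ 2)) /\
    (forall y : R, -1 <= y <= 1 -> H y <> 0).
Proof.
  intros H HC _ _ (X & HX & HR).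
  destruct (rotational_profile H X HX HR) as (r & r1 & r2 & z1 & z2 & beta & n & HP).
  assert (Hin : forall y, -1 < y < 1 -> sqrt (1 - y ^ 2) < 2 * Rabs (H y)).
  { intros y. apply (profile_bound _ _ _ _ _ _ _ _ y HP). }
  assert (Hnz : forall y, -1 <= y <= 1 -> H y <> 0).
  { intros y Hy. destruct (Req_dec (y ^ 2) 1) as [E|E].
    - now apply endpoint_nonzero.
    - intros H0. specialize (Hin y ltac:(nra)). rewrite H0, Rabs_R0 in Hin.
      assert (T := sqrt_pos (1 - y ^ 2)). lra. }
  split; [|exact Hnz].
  intros y Hy. destruct (Req_dec (y ^ 2) 1) as [E|E].
  - rewrite E, Rminus_diag, sqrt_0. assert (T := Rabs_pos_lt _ (Hnz y Hy)). lra.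
  - apply Rlt_gt, Hin. nra.
Qed.
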